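(* Let $P=G/K$ be a symmetric space, where $G$ is a group of isometries of $P$ containing all geodesic symmetries, let $\Phi:P\to V$ be an equivariant embedding into a Euclidean vector space with corresponding representation $\rho:G\to O(V)$, and let $p\in P$. Then the second fundamental form $\alpha$ of $\Phi$ at $p$ takes values in $N^+$. If moreover $P$ is Kähler symmetric, then the $(1,1)$-part $\alpha^{(1,1)}$ of $\alpha$ is the projection of $\alpha$ onto $N^{++}$.
   Context: Equivariant embedding: an embedding $\Phi:P\to V$ into a finite-dimensional Euclidean vector space with a representation $\rho:G\to O(V)$ such that $\Phi(gx)=\rho(g)\Phi(x)$ for all $g\in G$, $x\in P$. $P$ is symmetric if for each $p\in P$ there is an isometry $s_p$ of $P$ fixing $p$ and reversing every geodesic through $p$. $P$ is Kähler symmetric if moreover $s_p$ lies in a circle group $S_p\cong\mathbb{S}^1$, $S_p\subset G$, fixing $p$ and acting like the complex unit scalars on $T_pP$ for some complex structure $J=J_p$ on $T_pP$ (these form the complex structure of the Kähler manifold $P$); $j_p\in S_p$ denotes the element acting on $T_pP$ as $J_p$, so $j_p^2=s_p$. $N=d\Phi(T_pP)^\perp\subset V$ is the normal space at $p$; $N^{\pm}$ are the $\pm1$-eigenspaces of $\rho(s_p)|_N$, so $N=N^+\oplus N^-$. In the Kähler symmetric case, $N^{++}\subset N^+$ is the $1$-eigenspace of $\rho(j_p)|_N$; ''projection'' means orthogonal projection. Extending $\alpha$ complex bilinearly and writing $X=X_{(1,0)}+X_{(0,1)}$ with $X_{(1,0)}=\frac12(X-iJX)$, $X_{(0,1)}=\frac12(X+iJX)$,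 one sets $\alpha^{(1,1)}(X,Y)=\alpha(X_{(1,0)},Y_{(0,1)})+\alpha(X_{(0,1)},Y_{(1,0)})$. *)

(* Defs.v *)
From HB Require Import structures.
From mathcomp Require Import all_boot all_order all_algebra complex.
From mathcomp Require Import all_classical all_reals all_analysis.
Set Implicit Arguments.
Unset Strict Implicit.
Unset Printing Implicit Defensive.
Import Order.TTheory GRing.Theory Num.Theory.
Import numFieldNormedType.Exports.
Local Open Scope classical_set_scope.
Local Open Scope ring_scope.

(* Vectors are row vectors, so a linear map is a matrix acting on the right:
   v |-> v *m A.  The matrix of a composite g \o f is thus A_f *m A_g, and
   d f_x (v) = v *m jacobian f x. *)

Section Smooth.
Context {R : realType} {V W : normedModType R}.

Fixpoint Ck (U : set V) (k : nat) (f : V -> W) : Prop :=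
  if k is k'.+1 then
    (forall x, U x -> differentiable f x) /\
    (forall v, Ck U k' (fun x => 'D_v f x))
  else forall x, U x -> {for x, continuous f}.

Definition smooth_on (U : set V) (f : V -> W) := forall k, Ck U k f.

End Smooth.

(* The values of [coords] outside [dom] and of [param] outside [cod] are
   irrelevant. *)
Record chart (R : realType) (n : nat) (P : topologicalType) := Chart {
  dom : set P;
  cod : set 'rV[R]_n;
  coords : P -> 'rV[R]_n;
  param : 'rV[R]_n -> P;
  dom_open : open dom;
  cod_open : open cod;
  coords_cod : forall x, dom x -> cod (coords x);
  param_dom : forall u, cod u -> dom (param u);
  coordsK : forall x, dom x -> param (coords x) = x;
  paramK : forall u, cod u -> coords (param u) = u;
  coords_continuous : forall x, dom x -> {for x, continuous coords};
  param_continuous : forall u, cod u -> {for u, continuous param} }.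

Record manifold (R : realType) (n : nat) := Manifold {
  carrier :> topologicalType;
  atlas : set (chart R n carrier);
  manifold_hausdorff : hausdorff_space carrier;
  manifold_second_countable : @second_countable carrier;
  atlas_cover : forall x : carrier, exists2 c, atlas c & dom c x;
  atlas_compatible : forall c c', atlas c -> atlas c' ->
    smooth_on (cod c `&` param c @^-1` dom c') (coords c' \o param c) }.

Section Riemannian.
Context {R : realType} {n : nat}.
Implicit Types (P : manifold R n).

(* The coordinate expression of f with respect to the charts c and c'. *)
Definition local_map P (c c' : chart R n P) (f : P -> P) :
  'rV[R]_n -> 'rV[R]_n := coords c' \o f \o param c.

Definition smooth_map P (f : P -> P) :=
  continuous f /\
  forall c c', atlas c -> atlas c' ->
    smooth_on (cod c `&` (f \o param c) @^-1` dom c') (local_map c c' f).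

(* [metric c u] is the Gram matrix (g_ij) at the point [param c u]. *)
Record riemannian_metric P := RiemannianMetric {
  metric : chart R n P -> 'rV[R]_n -> 'M[R]_n;
  metric_smooth : forall c, atlas c -> smooth_on (cod c) (metric c);
  metric_sym : forall c u, atlas c -> cod c u -> (metric c u)^T = metric c u;
  metric_pos : forall c u (X : 'rV[R]_n), atlas c -> cod c u -> X != 0 ->
    0 < (X *m metric c u *m X^T) 0 0;
  metric_compatible : forall c c' x, atlas c -> atlas c' ->
    dom c x -> dom c' x ->
    let A := jacobian (local_map c c' id) (coords c x) in
    metric c (coords c x) = A *m metric c' (coords c' x) *m A^T }.

Section WithMetric.
Context {P : manifold R n} (g : riemannian_metric P).

Definition preserves_metric (f : P -> P) :=
  forall c c' x, atlas c -> atlas c' -> dom c x -> dom c' (f x) ->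
    let A := jacobian (local_map c c' f) (coords c x) in
    metric g c (coords c x) = A *m metric g c' (coords c' (f x)) *m A^T.

Definition is_isometry (f : P -> P) :=
  smooth_map f /\ preserves_metric f /\
  exists f' : P -> P, [/\ cancel f f', cancel f' f & smooth_map f'].

(* [partial k f] is the derivative of f along the k-th coordinate. *)
Definition partial (k : 'I_n) (f : 'rV[R]_n -> R) (u : 'rV[R]_n) : R :=
  'D_(delta_mx 0 k) f u.

(* [christoffel c u i j k] is Gamma^k_{ij}. *)
Definition christoffel (c : chart R n P) (u : 'rV[R]_n) (i j k : 'I_n) : R :=
  2^-1 * \sum_l (invmx (metric g c u) k l *
    (partial i (fun v => metric g c v j l) u +
     partial j (fun v => metric g c v i l) u -
     partial l (fun v => metric g c v i j) u)).

(* gam restricted to the interval ]-eps, eps[ is a geodesic. *)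
Definition geodesic (eps : R) (gam : R -> P) :=
  forall t : R, `|t| < eps ->
    {for t, continuous gam} /\
    forall c, atlas c -> dom c (gam t) ->
      let x : R -> 'rV[R]_n := coords c \o gam in
      [/\ \forall r \near t, derivable x r 1,
          derivable (x^`())%classic t 1 &
          forall k, ((x^`())%classic^`())%classic t 0 k +
            \sum_i \sum_j christoffel c (x t) i j k *
              (x^`())%classic t 0 i * (x^`())%classic t 0 j = 0].

Definition geodesic_symmetry (p : P) (s : P -> P) :=
  [/\ is_isometry s, s p = p &
      forall (eps : R) (gam : R -> P), 0 < eps -> geodesic eps gam ->
        gam 0 = p -> forall t, `|t| < eps -> s (gam t) = gam (- t)].

Definition isometry_group (G : set (P -> P)) :=
  [/\ forall f, G f -> is_isometry f,
      G id,
      forall f h, G f -> G h -> G (f \o h) &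
      forall f, G f -> exists f', [/\ G f', cancel f f' & cancel f' f]].

Definition transitive_on (G : set (P -> P)) :=
  forall x y : P, exists2 f, G f & f x = y.

(* A parallel orthogonal almost complex structure; [cplx c u] is the matrix of
   J in the chart c, i.e. J e_j = \sum_i (cplx c u j i) e_i, and the last field
   says that the covariant derivative of J vanishes. *)
Record kaehler_structure := KaehlerStructure {
  cplx : chart R n P -> 'rV[R]_n -> 'M[R]_n;
  cplx_smooth : forall c, atlas c -> smooth_on (cod c) (cplx c);
  cplx_compatible : forall c c' x, atlas c -> atlas c' ->
    dom c x -> dom c' x ->
    let A := jacobian (local_map c c' id) (coords c x) in
    cplx c (coords c x) *m A = A *m cplx c' (coords c' x);
  cplx_sqr : forall c u, atlas c -> cod c u ->
    cplx c u *m cplx c u = - 1%:M;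
  cplx_orthogonal : forall c u, atlas c -> cod c u ->
    cplx c u *m metric g c u *m (cplx c u)^T = metric g c u;
  cplx_parallel : forall c u i j k, atlas c -> cod c u ->
    partial k (fun v => cplx c v j i) u +
    \sum_l (christoffel c u k l i * cplx c u j l -
            christoffel c u k j l * cplx c u l i) = 0 }.

(* S is a subgroup of G isomorphic to R / 2 pi Z, fixing p and acting on T_p P
   by the complex scalars exp (i t) = cos t + i sin t. *)
Definition circle_group_at (G : set (P -> P)) (J : kaehler_structure) (p : P)
    (S : set (P -> P)) :=
  S `<=` G /\
  exists e : R -> P -> P,
    [/\ S = range e,
        forall a b, e (a + b) = e a \o e b,
        forall a, e a = id <-> exists k : int, a = k%:~R * (2 * pi),
        forall x, continuous (e^~ x) &
        forall a, e a p = p /\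
          forall c, atlas c -> dom c p ->
            jacobian (local_map c c (e a)) (coords c p) =
              (cos a)%:M + sin a *: cplx J c (coords c p)].

Definition kaehler_symmetric (G : set (P -> P)) (s : P -> P -> P)
    (J : kaehler_structure) (S : P -> set (P -> P)) :=
  forall q, circle_group_at G J q (S q) /\ S q (s q).

(* f lies in S and acts on T_p P as J_p. *)
Definition acts_as_J (J : kaehler_structure) (S : set (P -> P)) (p : P)
    (f : P -> P) :=
  S f /\ forall c, atlas c -> dom c p ->
    jacobian (local_map c c f) (coords c p) = cplx J c (coords c p).

End WithMetric.
End Riemannian.

Section Embedding.
Context {R : realType} {n m : nat} {P : manifold R n}.

Definition orthogonal_representation (G : set (P -> P))
    (rho : (P -> P) -> 'M[R]_m) :=
  (forall f, G f -> rho f *m (rho f)^T = 1%:M) /\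
  (forall f h, G f -> G h -> rho (h \o f) = rho f *m rho h).

Definition embedding (Phi : P -> 'rV[R]_m) :=
  [/\ forall c, atlas c -> smooth_on (cod c) (Phi \o param c),
      forall c u, atlas c -> cod c u -> row_free (jacobian (Phi \o param c) u),
      injective Phi &
      forall U : set P, open U <->
        exists2 W : set 'rV[R]_m, open W & U = Phi @^-1` W].

Definition equivariant (G : set (P -> P)) (rho : (P -> P) -> 'M[R]_m)
    (Phi : P -> 'rV[R]_m) :=
  forall f x, G f -> Phi (f x) = Phi x *m rho f.

(* Subspaces of 'rV_m are row spaces of matrices. *)
Definition orthocompl k (U : 'M[R]_(k, m)) : 'M[R]_m := kermx U^T.

Definition orthoproj (U : 'M[R]_m) : 'M[R]_m := proj_mx U (orthocompl U).

Variable Phi : P -> 'rV[R]_m.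
Variables (c : chart R n P) (p : P).

(* A tangent vector at p is given by its components X : 'rV_n in a chart c
   around p. *)
Definition normal_space : 'M[R]_m :=
  orthocompl (jacobian (Phi \o param c) (coords c p)).

(* alpha (X, Y) is the normal part of the derivative along X of d Phi (Y~),
   where Y~ is the extension of Y with constant components in c; the normal part
   does not depend on the extension. *)
Definition second_fundamental_form (X Y : 'rV[R]_n) : 'rV[R]_m :=
  'D_X (fun u => 'D_Y (Phi \o param c) u) (coords c p) *m orthoproj normal_space.

(* For F = rho s_p this is N^+, for F = rho j_p it is N^{++}. *)
Definition normal_fixed (F : 'M[R]_m) : 'M[R]_m :=
  (normal_space :&: eigenspace F 1)%MS.

End Embedding.

Section Complexification.
Context {R : realType} {n m : nat}.

Definition complexify k l (A : 'M[R]_(k, l)) : 'M[R[i]%C]_(k, l) :=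
  map_mx (real_complex R) A.

Definition re_part k (Z : 'rV[R[i]%C]_k) : 'rV[R]_k := map_mx (@complex.Re R) Z.
Definition im_part k (Z : 'rV[R[i]%C]_k) : 'rV[R]_k := map_mx (@complex.Im R) Z.

(* The complex bilinear extension of a real bilinear map. *)
Definition bilinear_ext (a : 'rV[R]_n -> 'rV[R]_n -> 'rV[R]_m)
    (Z W : 'rV[R[i]%C]_n) : 'rV[R[i]%C]_m :=
  complexify (a (re_part Z) (re_part W) - a (im_part Z) (im_part W)) +
  'i%C *: complexify (a (re_part Z) (im_part W) + a (im_part Z) (re_part W)).

Variable J : 'M[R]_n.

Definition part10 (X : 'rV[R]_n) : 'rV[R[i]%C]_n :=
  2^-1 *: (complexify X - 'i%C *: complexify (X *m J)).
Definition part01 (X : 'rV[R]_n) : 'rV[R[i]%C]_n :=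
  2^-1 *: (complexify X + 'i%C *: complexify (X *m J)).

Definition part11 (a : 'rV[R]_n -> 'rV[R]_n -> 'rV[R]_m) (X Y : 'rV[R]_n) :
  'rV[R[i]%C]_m :=
  bilinear_ext a (part10 X) (part01 Y) + bilinear_ext a (part01 X) (part10 Y).

End Complexification.

(* Main.v *)
(** An isometry [f] in [G] fixing [p] satisfies [Phi \o f = rho f \o Phi];
    differentiating twice at [p] and taking normal parts gives
    [alpha (df X, df Y) = rho f (alpha (X, Y))].  For [f = s_p] one has
    [df = -1], so [alpha] is fixed by [rho s_p].  For [f = j_p] one has
    [df = J], so [alpha11 (X, Y) = (alpha (X, Y) + alpha (JX, JY)) / 2] is
    [(1 + rho j_p) / 2] applied to [alpha (X, Y)], which is the orthogonal
    projection onto the fixed vectors of [rho j_p], because [J^2 = -1] makes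
    [(rho j_p)^2] fix [alpha (X, Y)].

    That [d s_p = -1] requires a geodesic through [p] in every direction.  It is
    obtained by Picard iteration in one chart; the geodesic equation then holds
    in all other charts because its Euler-Lagrange form
    [x'' h + x' D_x' h - 1/2 D h (x', x') = 0] is covariant, the second
    derivatives of the transition map cancelling by their symmetry. *)
Require Import Defs.
From HB Require Import structures.
From mathcomp Require Import all_boot all_order all_algebra complex.
From mathcomp Require Import all_classical all_reals all_analysis.
From mathcomp Require Import ring lra.
Set Implicit Arguments.
Unset Strict Implicit.
Unset Printing Implicit Defensive.
Import Order.TTheory GRing.Theory Num.Theory.
Import numFieldNormedType.Exports.
Local Open Scope classical_set_scope.
Local Open Scope ring_scope.

(** * Matrix-valued derivatives and the symmetry of second derivatives *)

Lemma is_derive1E (R : realType) (W : normedModType R) (f : R -> W) (t : R) df :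
  is_derive t 1 f df -> (f^`())%classic t = df.
Proof. by move=> [_ fE]; rewrite derive1E. Qed.

Lemma derive_lineE (R : realType) (V W : normedModType R) (f : V -> W) x v :
  'D_v f x = 'D_1 (fun t : R => f (t *: v + x)) 0.
Proof.
pose g (t : R) := f (t *: v + x).
rewrite -/g /derive; set d := (fun _ : R => _); set d' := (fun _ : R => _).
suff -> : d = d' by [].
by apply/funext => t; rewrite /d /d' /g /= addr0 scale0r add0r [_%:A]mulr1.
Qed.

Section MatrixCalculus.
Context {R : realType} {V : normedModType R}.

Lemma is_derive_mxP m n (M : V -> 'M[R]_(m, n)) t v dM :
  is_derive t v M dM <->
  forall i j, is_derive t v (fun x => M x i j) (dM i j).
Proof.
split=> [[Mt <-] i j|Mt].
  rewrite derive_mx// mxE; apply: derivableP.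
  by move/derivable_mxP : Mt; exact.
have Mtd : derivable M t v.
  by apply/derivable_mxP => i j; exact: (@ex_derive _ _ _ _ _ _ _ (Mt i j)).
apply: DeriveDef => //; rewrite derive_mx//.
apply/matrixP => i j; rewrite mxE.
exact: (@derive_val _ _ _ _ _ _ _ (Mt i j)).
Qed.

Lemma is_derive_sumT (I : finType) (W : normedModType R) (h : I -> V -> W)
    t v (dh : I -> W) :
  (forall i, is_derive t v (h i) (dh i)) ->
  is_derive t v (fun x => \sum_i h i x) (\sum_i dh i).
Proof.
move=> H; suff : forall s : seq I,
    is_derive t v (fun x => \sum_(i <- s) h i x) (\sum_(i <- s) dh i) by exact.
elim=> [|i s IH].
  rewrite big_nil; under eq_fun do rewrite big_nil.
  exact: is_derive_cst.
rewrite big_cons; under eq_fun do rewrite big_cons.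
exact: is_deriveD.
Qed.

Lemma is_derive_mul (f g : V -> R) t v df dg :
  is_derive t v f df -> is_derive t v g dg ->
  is_derive t v (fun x => f x * g x) (df * g t + f t * dg).
Proof.
move=> ft gt; apply: is_derive_eq (is_deriveM ft gt) _.
by rewrite addrC; congr (_ + _); exact: mulrC.
Qed.

Lemma is_derive_mulmx m n k (M : V -> 'M[R]_(m, n)) (N : V -> 'M[R]_(n, k))
    t v dM dN :
  is_derive t v M dM -> is_derive t v N dN ->
  is_derive t v (fun x => M x *m N x) (dM *m N t + M t *m dN).
Proof.
move=> /is_derive_mxP dMt /is_derive_mxP dNt; apply/is_derive_mxP => i j.
under eq_fun do rewrite mxE.
rewrite !mxE -big_split /=; apply: is_derive_sumT => l.
exact: is_derive_mul.
Qed.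

Lemma is_derive_trmx m n (M : V -> 'M[R]_(m, n)) t v dM :
  is_derive t v M dM -> is_derive t v (fun x => (M x)^T) dM^T.
Proof.
move=> /is_derive_mxP dMt; apply/is_derive_mxP => i j.
by under eq_fun do rewrite mxE; rewrite mxE.
Qed.

Lemma diff_is_derive (W : normedModType R) (f : V -> W) x v :
  differentiable f x -> is_derive x v f ('D_v f x).
Proof. by move=> fx; exact/derivableP/diff_derivable. Qed.

(** The inner map only needs a derivative in one direction. Restricted to the line through [x] it
    becomes a function of one real variable, for which derivable means differentiable, so the chain
    rule for differentials applies. *)
Lemma is_derive_comp_diff (U W : normedModType R) (g : U -> V) (f : V -> W)
    x v dg :
  is_derive x v g dg -> differentiable f (g x) ->
  is_derive x v (f \o g) ('D_dg f (g x)).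
Proof.
move=> [gx dgE] fg; pose h (t : R) := g (t *: v + x).
have dh0 : differentiable h 0 by apply/derivable1_diffP; exact: (derivable1P g x v).1.
have h0 : h 0 = g x by rewrite /h scale0r add0r.
have fh : differentiable f (h 0) by rewrite h0.
have dh : 'd h 0 1 = dg.
  by rewrite -deriveE// -dgE (derive_lineE g).
have fhE : 'D_v (f \o g) x = 'D_1 (f \o h) 0 by exact: derive_lineE.
apply: DeriveDef.
  by apply: (derivable1P _ x v).2; apply/derivable1_diffP/(differentiable_comp dh0 fh).
rewrite fhE deriveE; last exact: (differentiable_comp dh0 fh).
rewrite (diff_comp dh0 fh) /= -/h dh -deriveE// ?h0//.
Qed.

End MatrixCalculus.

Section RowVectors.
Context {R : realType} {W : normedModType R} {n : nat}.

Lemma derive_sum_delta (f : 'rV[R]_n -> W) x v :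
  differentiable f x -> 'D_v f x = \sum_i v 0 i *: 'D_(delta_mx 0 i) f x.
Proof.
move=> fx; rewrite deriveE// {1}(row_sum_delta v) linear_sum.
by apply: eq_bigr => i _; rewrite linearZ/= deriveE.
Qed.

End RowVectors.

(** * Equality of mixed second derivatives *)

Section Schwarz.
Context {R : realType} {V : normedModType R}.
Implicit Types (f : V -> R) (x v w : V).

Lemma is_derive_line (W : normedModType R) (f : V -> W) x v (t : R) :
  differentiable f (x + t *: v) ->
  is_derive t 1 (fun t => f (x + t *: v)) ('D_v f (x + t *: v)).
Proof.
move=> fx; apply: (@is_derive_comp_diff _ _ _ _ (fun t : R => x + t *: v)) => //.
apply: is_derive_eq; first (apply: is_deriveD).
  have := @is_diff_scalel R _ t v => dsc.
  apply: DeriveDef; first exact/derivable1_diffP/ex_diff.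
  by rewrite deriveE ?diff_val//; exact: ex_diff.
by rewrite add0r scale1r.
Qed.

(** Two applications of the mean value theorem: first along [v] to the increment [phi] of [f] in the
    direction [w], then along [w] to the derivative ['D_v f]. *)
Lemma second_difference f x v w (h : R) : 0 < h ->
  (forall a b : R, 0 <= a <= h -> 0 <= b <= h ->
    differentiable f (x + a *: v + b *: w) /\
    differentiable (fun y => 'D_v f y) (x + a *: v + b *: w)) ->
  exists a b : R, [/\ 0 <= a <= h, 0 <= b <= h &
    f (x + h *: v + h *: w) - f (x + h *: v) - (f (x + h *: w) - f x) =
    h ^+ 2 * 'D_w (fun y => 'D_v f y) (x + a *: v + b *: w)].
Proof.
move=> h0 df.
pose phi a := f (x + a *: v + h *: w) - f (x + a *: v).
have dphi a : 0 <= a <= h -> is_derive a 1 phi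
    ('D_v f (x + a *: v + h *: w) - 'D_v f (x + a *: v)).
  move=> ah; apply: is_deriveB.
    under eq_fun do rewrite addrAC; rewrite addrAC.
    apply: is_derive_line; rewrite addrAC.
    by apply: (df a h _ _).1; rewrite // lexx ltW.
  apply: is_derive_line; rewrite -[_ + _]addr0 -(scale0r w).
  by apply: (df a 0 _ _).1; rewrite // lexx ltW.
have /MVT_segment : 0 <= h by exact: ltW.
move=> /(_ phi (fun a => 'D_v f (x + a *: v + h *: w) - 'D_v f (x + a *: v))) [].
- by move=> a /[!in_itv] /andP[a0 ah]; apply: dphi; rewrite !ltW.
- apply: derivable_within_continuous => a /[!in_itv]/= ah.
  exact: (@ex_derive _ _ _ _ _ _ _ (dphi a ah)).
move=> a /[!in_itv]/= ah; rewrite /phi scale0r !addr0 subr0 => phiE.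
pose psi b := 'D_v f (x + a *: v + b *: w).
have dpsi b : 0 <= b <= h -> is_derive b 1 psi
    ('D_w (fun y => 'D_v f y) (x + a *: v + b *: w)).
  move=> bh; apply: (@is_derive_line _ (fun y => 'D_v f y)).
  exact: (df a b _ _).2.
have /MVT_segment : 0 <= h by exact: ltW.
move=> /(_ psi (fun b => 'D_w (fun y => 'D_v f y) (x + a *: v + b *: w))) [].
- by move=> b /[!in_itv] /andP[b0 bh]; apply: dpsi; rewrite !ltW.
- apply: derivable_within_continuous => b /[!in_itv]/= bh.
  exact: (@ex_derive _ _ _ _ _ _ _ (dpsi b bh)).
move=> b /[!in_itv]/= bh; rewrite /psi scale0r addr0 subr0 => psiE.
exists a, b; split => //; rewrite phiE psiE; ring.
Qed.

Lemma near_small_combination x v w (A : set V) : nbhs x A ->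
  exists2 h : R, 0 < h & forall a b : R, 0 <= a <= h -> 0 <= b <= h ->
    A (x + a *: v + b *: w).
Proof.
move=> /nbhs_ballP[e /= e0 eA].
(* Side length [e / 2 / k] keeps the displacement below [e / 2]; the summand 1 makes [k] positive
   even if both vectors vanish. *)
pose k := `|v| + `|w| + 1.
have k0 : 0 < k by rewrite /k ltr_wpDl// addr_ge0.
exists (e / 2 / k) => [|a b /andP[a0 ah] /andP[b0 bh]].
  by rewrite !divr_gt0.
apply: eA; rewrite -ball_normE/= opprD addrA opprD addrA subrr add0r -opprD normrN.
apply: (@le_lt_trans _ _ (e / 2)); last by rewrite ltr_pdivrMr// ltr_pMr// ltr1n.
apply: (le_trans (ler_normD _ _)); rewrite !normrZ !ger0_norm//.
apply: (@le_trans _ _ (e / 2 / k * `|v| + e / 2 / k * `|w|)).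
  by rewrite lerD// ler_wpM2r.
rewrite -mulrDr -[leRHS](divfK (lt0r_neq0 k0)) ler_wpM2l//.
  by rewrite !divr_ge0// ltW.
by rewrite /k lerDl.
Qed.

(** The points [y] and [z] may differ, as do the intermediate points of two mean value theorems;
    continuity at [x] absorbs the difference. *)
Lemma eq_of_close_values (F1 F2 : V -> R) x :
  {for x, continuous F1} -> {for x, continuous F2} ->
  (forall A, nbhs x A -> exists y z, [/\ A y, A z & F1 y = F2 z]) ->
  F1 x = F2 x.
Proof.
move=> /cvgrPdist_lt c1 /cvgrPdist_lt c2 F12.
apply/eqP; rewrite -subr_eq0 -normr_le0; apply/ler_addgt0Pl => e e0.
rewrite addr0; have e2 : 0 < e / 2 by rewrite divr_gt0.
have [y [z [[y1 _] [_ z2] yz]]] := F12 _ (filterI (c1 _ e2) (c2 _ e2)).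
rewrite -(subrKA (F1 y)) (le_trans (ler_normD _ _))// [leRHS]splitr.
by rewrite lerD ?ltW// yz distrC.
Qed.

(** The second difference of [f] over the parallelogram spanned by [h *: v] and [h *: w] is
    symmetric in [v] and [w]. Read in either order it is [h ^+ 2] times a mixed derivative at a
    point as close to [x] as desired, and continuity of both mixed derivatives concludes. *)
Theorem schwarz f x v w :
  (\forall y \near x, differentiable f y) ->
  (\forall y \near x, differentiable (fun y => 'D_v f y) y) ->
  (\forall y \near x, differentiable (fun y => 'D_w f y) y) ->
  {for x, continuous (fun y => 'D_w (fun y => 'D_v f y) y)} ->
  {for x, continuous (fun y => 'D_v (fun y => 'D_w f y) y)} ->
  'D_w (fun y => 'D_v f y) x = 'D_v (fun y => 'D_w f y) x.
Proof.
move=> df dv dw cv cw; apply: (eq_of_close_values cv cw) => A xA.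
have H : \forall y \near x, [/\ differentiable f y,
    differentiable (fun y => 'D_v f y) y, differentiable (fun y => 'D_w f y) y &
    A y].
  apply: filter_app df; apply: filter_app dv; apply: filter_app dw.
  apply: filter_app xA; apply: nearW => y Ay dwy dvy dfy.
  exact: And4 dfy dvy dwy Ay.
have [h h0 Hh] := near_small_combination v w H.
have Hw a b (ah : 0 <= a <= h) (bh : 0 <= b <= h) := Hh b a bh ah.
have [//|a b ah bh|a [b [ah bh vw]]] := @second_difference f x v w h.
  by have [d1 d2 _ _] := Hh a b ah bh; exact: conj d1 d2.
have [//|a' b' ah' bh'|a' [b' [ah' bh' wv]]] := @second_difference f x w v h.
  by have [d1 _ d2 _] := Hw a' b' ah' bh'; rewrite addrAC; exact: conj d1 d2.
exists (x + a *: v + b *: w), (x + a' *: w + b' *: v); split.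
- by have [] := Hh a b ah bh.
- by have [_ _ _] := Hw a' b' ah' bh'; rewrite addrAC.
have E : f (x + h *: v + h *: w) - f (x + h *: v) - (f (x + h *: w) - f x) =
    f (x + h *: w + h *: v) - f (x + h *: w) - (f (x + h *: v) - f x).
  rewrite (addrAC x (h *: w)); move: (f _) (f _) (f _) (f _) => p q r s.
  by ring.
apply: (mulfI (lt0r_neq0 (exprn_gt0 2 h0))).
exact: etrans (esym vw) (etrans E wv).
Qed.

End Schwarz.

(** * Locally Lipschitz functions *)

Section LocallyLipschitz.
Context {R : realType}.

Lemma lipschitz_continuous (V W : normedModType R) (f : V -> W) (L : R) :
  (forall y z, `|f y - f z| <= L * `|y - z|) -> continuous f.
Proof.
(* [L] may be zero or negative, so it is enlarged to a positive constant before dividing. *)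
move=> fL y; have M0 : 0 < `|L| + 1 by rewrite ltr_wpDl.
apply/cvgrPdist_lt => e e0; near=> z.
apply: le_lt_trans (fL _ _) _.
apply: (@le_lt_trans _ _ ((`|L| + 1) * `|y - z|)).
  by rewrite ler_wpM2r// (le_trans (ler_norm _))// lerDl.
rewrite -ltr_pdivlMl//.
by near: z; apply: cvgr_dist_lt => //; rewrite mulr_gt0// invr_gt0.
Unshelve. all: by end_near. Qed.

(** The estimate concerns all pairs near [(x, x)], not only pairs containing [x]: Picard iteration
    compares two arbitrary nearby points. *)
Definition locally_lipschitz {V : normedModType R} (x : V) (f : V -> R) :=
  exists2 L : R, 0 <= L &
    \forall z \near (x, x), `|f z.1 - f z.2| <= L * `|z.1 - z.2|.

Section Closure.
Context {V : normedModType R} (x : V).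
Implicit Types f g : V -> R.

Lemma near_both (P : V -> Prop) :
  (\forall y \near x, P y) -> \forall z \near (x, x), P z.1 /\ P z.2.
Proof.
by move=> Px; near=> z; split; near: z; [exact: cvg_fst|exact: cvg_snd].
Unshelve. all: by end_near. Qed.

Lemma locally_lipschitz_continuous f :
  locally_lipschitz x f -> {for x, continuous f}.
Proof.
move=> [L L0 fL]; apply/cvgrPdist_lt => e e0.
have L1 : 0 < L + 1 by rewrite ltr_wpDl.
have : \forall y \near x, `|f x - f y| <= L * `|x - y|.
  have xy : (x, y) @[y --> x] --> (x, x).
    by apply: cvg_pair; [exact: cvg_cst|exact: cvg_id].
  exact: xy _ fL.
apply: filterS2 (nbhsx_ballx x (e / (L + 1)) (divr_gt0 e0 L1)) => y.
rewrite -ball_normE/= => xy /le_lt_trans; apply.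
rewrite -(divfK (lt0r_neq0 L1) e) [X in _ < X]mulrC.
apply: (@le_lt_trans _ _ ((L + 1) * `|x - y|)); last by rewrite ltr_pM2l.
by rewrite ler_wpM2r// lerDl.
Qed.

Lemma locally_lipschitz_bounded f : locally_lipschitz x f ->
  exists2 B : R, 0 <= B & \forall y \near x, `|f y| <= B.
Proof.
move=> /locally_lipschitz_continuous/cvgrPdist_le/(_ _ ltr01) fx.
exists (`|f x| + 1); first by rewrite addr_ge0.
apply: filterS fx => y fxy; rewrite -[f y](subKr (f x)).
by rewrite (le_trans (ler_normB _ _))// lerD.
Qed.

Lemma near_eq_locally_lipschitz f g : (\forall y \near x, f y = g y) ->
  locally_lipschitz x f -> locally_lipschitz x g.
Proof.
move=> /near_both fg [L L0 fL]; exists L => //.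
by apply: filterS2 fg fL => z [<- <-].
Qed.

Lemma locally_lipschitz_cst (a : R) : locally_lipschitz x (fun=> a).
Proof.
by exists 0 => //; near=> z; rewrite subrr normr0 mul0r.
Unshelve. all: by end_near. Qed.

Lemma locally_lipschitzD f g : locally_lipschitz x f ->
  locally_lipschitz x g -> locally_lipschitz x (fun y => f y + g y).
Proof.
move=> [L L0 fL] [M M0 gM]; exists (L + M); first exact: addr_ge0.
apply: filterS2 fL gM => z fL gM.
by rewrite opprD addrACA mulrDl (le_trans (ler_normD _ _))// lerD.
Qed.

Lemma locally_lipschitzN f : locally_lipschitz x f ->
  locally_lipschitz x (fun y => - f y).
Proof.
move=> [L L0 fL]; exists L => //; apply: filterS fL => z.
by rewrite -opprD normrN.
Qed.

Lemma locally_lipschitzM f g : locally_lipschitz x f ->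
  locally_lipschitz x g -> locally_lipschitz x (fun y => f y * g y).
Proof.
move=> fl gl; have [B B0 /near_both fB] := locally_lipschitz_bounded fl.
have [C C0 /near_both gC] := locally_lipschitz_bounded gl.
move: fl gl => [L L0 fL] [M M0 gM].
exists (L * C + B * M); first by rewrite addr_ge0// mulr_ge0.
near=> z.
have -> : f z.1 * g z.1 - f z.2 * g z.2 =
  (f z.1 - f z.2) * g z.1 + f z.2 * (g z.1 - g z.2) by ring.
rewrite [leRHS]mulrDl (le_trans (ler_normD _ _))// !normrM lerD//.
  rewrite mulrAC ler_pM//; first by near: z.
  by have [] : `|g z.1| <= C /\ `|g z.2| <= C by near: z.
rewrite -mulrA ler_pM//; last by near: z.
by have [] : `|f z.1| <= B /\ `|f z.2| <= B by near: z.
Unshelve. all: by end_near. Qed.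

(** Near [x] the values keep distance at least [|f x| / 2] from zero, and the difference of two
    inverses is the difference of the values over their product. *)
Lemma locally_lipschitzV f : f x != 0 -> locally_lipschitz x f ->
  locally_lipschitz x (fun y => (f y)^-1).
Proof.
move=> fx0 fl; have fx_gt0 : 0 < `|f x| by rewrite normr_gt0.
have /near_both fB : \forall y \near x, `|f x| / 2 <= `|f y|.
  have /cvgrPdist_le := locally_lipschitz_continuous fl.
  move=> /(_ _ (divr_gt0 fx_gt0 (ltr0n _ 2))).
  apply: filterS => y fxy.
  have := ler_normD (f x - f y) (f y); rewrite subrK; move: fxy; lra.
move: fl => [L L0 fL]; exists (L / (`|f x| / 2) ^+ 2).
  by rewrite divr_ge0// sqr_ge0.
apply: filterS2 fB fL => z [z1 z2] fz.
have b0 : 0 < `|f x| / 2 by rewrite divr_gt0.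
have f1 : f z.1 != 0 by rewrite -normr_gt0 (lt_le_trans b0).
have f2 : f z.2 != 0 by rewrite -normr_gt0 (lt_le_trans b0).
have -> : (f z.1)^-1 - (f z.2)^-1 = - (f z.1 - f z.2) / (f z.1 * f z.2).
  by field; rewrite f1 f2.
rewrite mulrAC normrM normrN normfV ler_pM// ?invr_ge0//.
rewrite lef_pV2 ?posrE ?normr_gt0 ?mulf_neq0 ?exprn_gt0//.
by rewrite normrM expr2 ler_pM// ltW.
Qed.

Lemma locally_lipschitz_sum (I : Type) (r : seq I) (P : pred I)
    (F : I -> V -> R) : (forall i, locally_lipschitz x (F i)) ->
  locally_lipschitz x (fun y => \sum_(i <- r | P i) F i y).
Proof.
move=> Fl; elim: r => [|i r IH].
  by under eq_fun do rewrite big_nil; exact: locally_lipschitz_cst.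
under eq_fun do rewrite big_cons.
by case: (P i) => //; exact: locally_lipschitzD.
Qed.

Lemma locally_lipschitz_prod (I : Type) (r : seq I) (P : pred I)
    (F : I -> V -> R) : (forall i, locally_lipschitz x (F i)) ->
  locally_lipschitz x (fun y => \prod_(i <- r | P i) F i y).
Proof.
move=> Fl; elim: r => [|i r IH].
  by under eq_fun do rewrite big_nil; exact: locally_lipschitz_cst.
under eq_fun do rewrite big_cons.
by case: (P i) => //; exact: locally_lipschitzM.
Qed.

Lemma locally_lipschitz_det n (M : V -> 'M[R]_n) :
  (forall i j, locally_lipschitz x (fun y => M y i j)) ->
  locally_lipschitz x (fun y => \det (M y)).
Proof.
move=> Ml; apply: locally_lipschitz_sum => s.
apply: locally_lipschitzM; first exact: locally_lipschitz_cst.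
exact: locally_lipschitz_prod.
Qed.

(** Cramer's rule expresses the inverse through determinants. The formula is used only near [x],
    where the determinant stays nonzero; at singular matrices [invmx] returns its argument. *)
Lemma locally_lipschitz_invmx n (M : V -> 'M[R]_n) i j :
  M x \in unitmx -> (forall i j, locally_lipschitz x (fun y => M y i j)) ->
  locally_lipschitz x (fun y => invmx (M y) i j).
Proof.
rewrite unitmxE unitfE => Mx Ml; have dl := locally_lipschitz_det Ml.
apply: (@near_eq_locally_lipschitz
  (fun y => (\det (M y))^-1 * cofactor (M y) j i)).
  have : \forall y \near x, \det (M y) != 0.
    by apply: cvgr_neq0 Mx; exact: locally_lipschitz_continuous dl.
  apply: filterS => y My; rewrite /invmx unitmxE unitfE My.
  by rewrite 2!mxE.
apply: locally_lipschitzM; first exact: locally_lipschitzV.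
apply: locally_lipschitzM; first exact: locally_lipschitz_cst.
apply: locally_lipschitz_det => k l.
by under eq_fun do rewrite !mxE.
Qed.

Lemma locally_lipschitz_comp (W : normedModType R) (f : W -> R) (p : V -> W) :
  (forall y z, `|p y - p z| <= `|y - z|) ->
  locally_lipschitz (p x) f -> locally_lipschitz x (f \o p).
Proof.
move=> pl [L L0 fL]; exists L => //.
have pc : {for x, continuous p}.
  by apply: (@lipschitz_continuous _ _ _ 1) => y z; rewrite mul1r.
have : (p z.1, p z.2) @[z --> (x, x)] --> (p x, p x).
  apply: cvg_pair => /=.
    by apply: (@cvg_comp _ _ _ fst p _ _ _ _ pc); exact: cvg_fst.
  by apply: (@cvg_comp _ _ _ snd p _ _ _ _ pc); exact: cvg_snd.
move=> /(_ _ fL) pL.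
have {}pL : \forall z \near (x, x),
    `|f (p z.1) - f (p z.2)| <= L * `|p z.1 - p z.2| by exact: pL.
near=> z; apply: (@le_trans _ _ (L * `|p z.1 - p z.2|)); last by rewrite ler_wpM2l.
by near: z; exact: pL.
Unshelve. all: by end_near. Qed.

End Closure.

Lemma coord_le_mx_norm m n (M : 'M[R]_(m, n)) i j : `|M i j| <= `|M|.
Proof.
by rewrite [leRHS]/Num.Def.normr/= mx_normrE; exact: (le_bigmax _ _ (i, j)).
Qed.

Lemma mx_norm_le m n (M : 'M[R]_(m, n)) (e : R) : 0 <= e ->
  (forall i j, `|M i j| <= e) -> `|M| <= e.
Proof.
by move=> e0 Me; rewrite /Num.Def.normr/= mx_normrE; apply: bigmax_le => // -[].
Qed.

Lemma locally_lipschitz_coord n (x : 'rV[R]_n) i :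
  locally_lipschitz x (fun y => y 0 i).
Proof.
exists 1 => //; near=> z; rewrite mul1r.
by have := coord_le_mx_norm (z.1 - z.2) 0 i; rewrite !mxE.
Unshelve. all: by end_near. Qed.

(** The partial derivatives are bounded by [B i] on a ball around [x]; the mean value theorem along
    the segment joining two points of the ball then gives the constant [\sum_i B i], each coordinate
    being at most the norm. *)
Lemma C1_locally_lipschitz n (x : 'rV[R]_n) (f : 'rV[R]_n -> R) :
  (\forall y \near x, differentiable f y) ->
  (forall v, {for x, continuous (fun y => 'D_v f y)}) ->
  locally_lipschitz x f.
Proof.
move=> fd fc; pose B i := `|'D_(delta_mx 0 i) f x| + 1.
exists (\sum_i B i); first by apply: sumr_ge0 => i _; rewrite addr_ge0.
have : \forall y \near x, differentiable f y /\
    forall i, `|'D_(delta_mx 0 i) f y| <= B i.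
  near=> y; split; first by near: y.
  near: y; apply: filter_forall => i.
  have /cvgrPdist_le/(_ _ ltr01) := fc (delta_mx 0 i).
  apply: filterS => y fxy; rewrite -[X in `|X| <= _](subKr ('D_(delta_mx 0 i) f x)).
  by rewrite (le_trans (ler_normB _ _))// lerD.
move=> /nbhs_ballP[e /= e0 xe].
have zB := near_both (nbhsx_ballx x e e0).
near=> z; have [] : ball x e z.1 /\ ball x e z.2 by near: z.
rewrite -ball_normE/= => z1 z2.
(* Balls are convex, so the whole segment stays where the bounds hold. *)
have seg (t : R) : 0 <= t <= 1 -> ball x e (z.2 + t *: (z.1 - z.2)).
  move=> /andP[t0 t1]; rewrite -ball_normE/=.
  have -> : x - (z.2 + t *: (z.1 - z.2)) = (1 - t) *: (x - z.2) + t *: (x - z.1).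
    by apply/matrixP => i j; rewrite !mxE; ring.
  rewrite (le_lt_trans (ler_normD _ _))// !normrZ !ger0_norm ?subr_ge0//.
  set p := `|x - z.2| in z2 *; set q := `|x - z.1| in z1 *.
  have pqe : Num.max p q < e by rewrite gt_max z2.
  apply: le_lt_trans pqe.
  have -> : Num.max p q = (1 - t) * Num.max p q + t * Num.max p q by ring.
  by rewrite lerD// ler_wpM2l ?subr_ge0// le_max lexx ?orbT.
have dphi (t : R) : 0 <= t <= 1 -> is_derive t 1 (fun t : R => f (z.2 + t *: (z.1 - z.2)))
    ('D_(z.1 - z.2) f (z.2 + t *: (z.1 - z.2))).
  by move=> t01; apply: is_derive_line; exact: (xe _ (seg t t01)).1.
have [||t t01] := @MVT_segment _ (fun t : R => f (z.2 + t *: (z.1 - z.2)))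
    (fun t : R => 'D_(z.1 - z.2) f (z.2 + t *: (z.1 - z.2))) _ _ ler01.
- by move=> t /[!in_itv] /andP[t0 t1]; apply: dphi; rewrite !ltW.
- apply: derivable_within_continuous => t /[!in_itv]/= t01.
  exact: (@ex_derive _ _ _ _ _ _ _ (dphi t t01)).
rewrite scale1r scale0r addr0 subr0 mulr1 [z.2 + _]addrC subrK => ->.
have [fdt fB] := xe _ (seg t t01).
rewrite derive_sum_delta// mulr_suml (le_trans (ler_norm_sum _ _ _))//.
apply: ler_sum => i _; rewrite normrM mulrC ler_pM//.
exact: coord_le_mx_norm.
Unshelve. all: by end_near. Qed.

End LocallyLipschitz.

(** * Picard iteration *)

Section Clamp.
Context {R : realType}.

Definition clamp (a b x : R) : R := Num.max a (Num.min x b).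

Lemma clamp_itv a b x : a <= b -> a <= clamp a b x <= b.
Proof. by move=> ab; rewrite /clamp le_max lexx/= ge_max ab ge_min lexx orbT. Qed.

Lemma clamp_id a b x : a <= x <= b -> clamp a b x = x.
Proof. by rewrite /clamp => /andP[ax xb]; rewrite min_l// max_r. Qed.

Lemma clamp_lipschitz a b x y : `|clamp a b x - clamp a b y| <= `|x - y|.
Proof.
wlog xy : x y / x <= y => [H|].
  case: (leP x y) => [/H//|/ltW /H]; by rewrite distrC [`|y - x|]distrC.
rewrite [leRHS]distrC [leRHS]ger0_norm ?subr_ge0// /clamp ler_norml.
case: (leP a (Num.min x b)); case: (leP a (Num.min y b));
  by case: (leP x b); case: (leP y b) => *; lra.
Qed.

End Clamp.

(** * Antiderivatives and the mean value inequality *)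

Section Antiderivative.
Context {R : realType}.

Lemma antiderivative (f : R -> R) (T : R) : 0 < T -> continuous f ->
  exists2 F : R -> R, F 0 = 0 & forall t : R, `|t| <= T -> is_derive t 1 F (f t).
Proof.
move=> T0 cf; pose mu := @lebesgue_measure R.
(* Starting at [- T - 1] makes every point of [[-T, T]], endpoints included, interior to the
   interval of integration, so the derivative is two-sided. *)
pose H x := (\int[mu]_(t in [set` `[(- T - 1)%R, x]]) (f t))%R.
exists (fun t : R => H t - H 0); first by rewrite subrr.
move=> t; rewrite ler_norml => /andP[tl tu].
have [||||dH HE] := @continuous_FTC1_closed R f (- T - 1) t (T + 1).
- lra.
- apply: continuous_compact_integrable; first exact: segment_compact.
  exact: continuous_subspaceT.
- lra.
- exact: cf.
have {}dH : is_derive t 1 H (f t).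
  by apply: DeriveDef; [exact: dH|rewrite -HE derive1E].
have := is_deriveB dH (is_derive_cst (H 0) t 1).
by rewrite subr0.
Qed.

Lemma antiderivative_rV n (f : R -> 'rV[R]_n) (T : R) (z : 'rV[R]_n) :
  0 < T -> continuous f ->
  exists2 F : R -> 'rV[R]_n, F 0 = z &
    forall t : R, `|t| <= T -> is_derive t 1 F (f t).
Proof.
move=> T0 cf.
have fi i : exists F : R -> R, F 0 = 0 /\
    forall t : R, `|t| <= T -> is_derive t 1 F (f t 0 i).
  have [|F F0 dF] := @antiderivative (fun t : R => f t 0 i) T T0; last by exists F.
  move=> t; apply: (@continuous_comp _ _ _ f (fun v => v 0 i)); first exact: cf.
  exact: coord_continuous.
have {fi}[F FE] := choice fi.
exists (fun t : R => \row_i (z 0 i + F i t)) => [|t tT].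
  by apply/rowP => i; rewrite mxE (FE i).1 addr0.
apply/is_derive_mxP => i j; rewrite ord1.
under eq_fun do rewrite mxE.
apply: is_derive_eq; last exact: add0r.
by apply: is_deriveD; exact: (FE j).2.
Qed.

(** The mean value theorem applies to each entry separately, and the norm is the maximum of the
    absolute values of the entries. *)
Lemma mean_value_bound n (f df : R -> 'rV[R]_n) (B T : R) :
  (forall t : R, `|t| <= T -> is_derive t 1 f (df t)) ->
  (forall t : R, `|t| <= T -> `|df t| <= B) ->
  forall t : R, `|t| <= T -> `|f t - f 0| <= B * T.
Proof.
move=> fd fB t tT.
have T0 : 0 <= T by exact: le_trans tT.
have B0 : 0 <= B by apply: le_trans (fB t tT).
apply: mx_norm_le => [|i j]; first exact: mulr_ge0.
have sub (s : R) : (0 <= s <= t) || (t <= s <= 0) -> `|s| <= T.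
  by move: tT; rewrite !ler_norml; lra.
have dfj (s : R) : `|s| <= T -> is_derive s 1 (fun s : R => f s i j) (df s i j).
  by move=> /fd /is_derive_mxP.
have main (a b : R) : a <= b -> (forall s : R, a <= s <= b -> `|s| <= T) ->
    `|f b i j - f a i j| <= B * (b - a).
  move=> ab abT.
  have [||s sab ->] := @MVT_segment _ (fun s : R => f s i j) (fun s : R => df s i j) _ _ ab.
  - by move=> s /[!in_itv] /andP[sa sb]; apply/dfj/abT; rewrite !ltW.
  - apply: derivable_within_continuous => s /[!in_itv]/= /abT /dfj ds.
    exact: (@ex_derive _ _ _ _ _ _ _ ds).
  rewrite normrM [`|b - a|]ger0_norm ?subr_ge0// ler_wpM2r ?subr_ge0//.
  by apply: (le_trans (coord_le_mx_norm _ _ _)); apply/fB/abT; move: sab; rewrite in_itv.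
rewrite !mxE; case: (leP 0 t) => t0.
  apply: le_trans (main _ _ t0 _) _ => [s s0|]; first by rewrite sub// s0.
  by rewrite subr0 ler_wpM2l// (le_trans (ler_norm t)).
rewrite distrC; apply: le_trans (main _ _ (ltW t0) _) _ => [s s0|].
  by rewrite sub// s0 orbT.
by rewrite sub0r ler_wpM2l// -ltr0_norm.
Qed.

End Antiderivative.

Section GeometricLimit.
Context {R : realType}.

Lemma small_geometric (C e : R) : 0 < e -> exists k : nat, C / 2 ^+ k < e.
Proof.
move=> e0.
have h1 : `|2^-1 : R| < 1 by rewrite ger0_norm ?invr_ge0// invf_lt1// ltr1n.
have /cvgrPdist_lt/(_ _ e0)[k _ /(_ k (leqnn k))] := cvg_geometric C h1.
rewrite sub0r normrN /geometric/= exprVn => /(le_lt_trans (ler_norm _)).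
by exists k.
Qed.

Lemma geometric_limit n (u : nat -> 'rV[R]_n) (C : R) :
  (forall k, `|u k.+1 - u k| <= C / 2 ^+ k) ->
  exists l, forall k, `|u k - l| <= 2 * C / 2 ^+ k.
Proof.
move=> uC.
have C0 : 0 <= C by have := uC 0; rewrite expr0 divr1; exact: le_trans.
(* The subtracted term is the remaining tail of the geometric series; with it the induction on [m]
   closes. *)
have um k m : `|u (k + m)%N - u k| <= 2 * C / 2 ^+ k - 2 * C / 2 ^+ (k + m).
  elim: m => [|m IH]; first by rewrite addn0 !subrr normr0.
  rewrite -(subrKA (u (k + m)%N)) addnS.
  apply: le_trans (ler_normD _ _) _; apply: le_trans (lerD (uC _) IH) _.
  rewrite exprS invfM; move: (2 ^+ (k + m))^-1 (2 ^+ k)^-1 => p q.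
  by rewrite le_eqVlt; apply/orP; left; apply/eqP; field.
have uk k m : (k <= m)%N -> `|u m - u k| <= 2 * C / 2 ^+ k.
  move=> /subnKC <-; apply: le_trans (um _ _) _.
  by rewrite lerBlDr lerDl !mulr_ge0// invr_ge0 exprn_ge0.
have /cvg_ex[l ul] : cvgn u.
  apply/cauchy_cvgP/cauchy_exP => e e0.
  have [k ke] := small_geometric (2 * C) e0.
  exists (u k); exists k => // m /= /uk mk.
  by rewrite -ball_normE/= distrC (le_lt_trans mk).
exists l => k; apply/ler_addgt0Pl => e e0.
have /cvgrPdist_lt/(_ _ e0)[m _ lm] := ul.
have := lm (maxn m k) (leq_maxl m k); have := uk _ _ (leq_maxr m k).
rewrite -(subrKA (u (maxn m k)) (u k)) distrC => kl lu.
by rewrite addrC (le_trans (ler_normD _ _))// lerD// [leLHS]distrC ltW.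
Qed.

End GeometricLimit.

Section Picard.
Context {R : realType} {n : nat} (G : 'rV[R]_n -> 'rV[R]_n) (L : R).
Context (z0 : 'rV[R]_n).
Hypothesis G_lip : forall y z, `|G y - G z| <= L * `|y - z|.
Hypothesis L0 : 0 <= L.

(** This choice gives [L * T <= 1 / 2], the contraction ratio; the summand 1 covers [L = 0]. *)
Let T : R := (2 * (L + 1))^-1.
Let clamp := clamp (- T) T.

Let T0 : 0 < T.
Proof. by rewrite invr_gt0 mulr_gt0// ltr_wpDl. Qed.

Let LT : L * T <= 2^-1.
Proof.
have : T * (2 * (L + 1)) = 1 by rewrite mulVf// mulf_neq0// gt_eqF// ltr_wpDl.
by have := T0; lra.
Qed.

Let NTT : - T <= T. Proof. by have := T0; lra. Qed.

Let clamp_le t : `|clamp t| <= T.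
Proof. by rewrite ler_norml clamp_itv. Qed.

Let clampE t : `|t| <= T -> clamp t = t.
Proof. by rewrite ler_norml; exact: clamp_id. Qed.

Let clamp_continuous : continuous clamp.
Proof.
by apply: (@lipschitz_continuous R _ _ _ 1) => s t; rewrite mul1r clamp_lipschitz.
Qed.

Let G_continuous : continuous G.
Proof. exact: lipschitz_continuous G_lip. Qed.

(* Clamping the time to [-T, T] keeps the iterates continuous on the whole line
   and makes the contraction estimate uniform. *)
Let picard_step (x y : R -> 'rV[R]_n) := exists F : R -> 'rV[R]_n,
  [/\ F 0 = z0, forall t : R, `|t| <= T -> is_derive t 1 F (G (x t)) &
      forall t, y t = F (clamp t)].

Let picard_step_continuous x y : picard_step x y -> continuous y.
Proof.
move=> [F [_ dF yE]] t.
have -> : y = F \o clamp by apply/funext => s; rewrite yE.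
apply: continuous_comp; first exact: clamp_continuous.
apply/differentiable_continuous/derivable1_diffP.
exact: (@ex_derive _ _ _ _ _ _ _ (dF _ (clamp_le t))).
Qed.

Let picard_step_ex x : continuous x -> exists y, picard_step x y.
Proof.
move=> cx.
have [|F F0 dF] := @antiderivative_rV R n (G \o x) T z0 T0.
  by move=> t; apply: continuous_comp; [exact: cx|exact: G_continuous].
by exists (F \o clamp), F.
Qed.

(** The derivatives differ by at most [L * d], hence the antiderivatives, equal at 0, by at most
    [L * d * T]. *)
Let picard_step_contract x1 x2 y1 y2 (d : R) :
  picard_step x1 y1 -> picard_step x2 y2 ->
  (forall t, `|x1 t - x2 t| <= d) -> forall t, `|y1 t - y2 t| <= d / 2.
Proof.
move=> [F1 [F10 dF1 y1E]] [F2 [F20 dF2 y2E]] x12 t; rewrite y1E y2E.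
have d0 : 0 <= d by exact: le_trans (x12 0).
have := @mean_value_bound R n (fun t : R => F1 t - F2 t)
  (fun t : R => G (x1 t) - G (x2 t)) (L * d) T _ _ _ (clamp_le t).
rewrite F10 F20 subrr subr0 => H; apply: le_trans (H _ _) _.
- by move=> s sT; apply: is_deriveB; [exact: dF1|exact: dF2].
- by move=> s _; rewrite (le_trans (G_lip _ _))// ler_wpM2l.
by rewrite mulrAC [leRHS]mulrC ler_wpM2r.
Qed.

(** The iterates of the constant function [z0] converge uniformly at a geometric rate; their limit
    is continuous and is a fixed point of the Picard step. *)
Theorem picard : exists (e : R) (X : R -> 'rV[R]_n), [/\ 0 < e, X 0 = z0 &
  forall t : R, `|t| < e -> is_derive t 1 X (G (X t))].
Proof.
(* The step becomes a total function, with an arbitrary value at discontinuous arguments. *)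
have [s sE] : exists s, forall x, continuous x -> picard_step x (s x).
  have /choice[s sE] x : exists y, continuous x -> picard_step x y.
    have [/picard_step_ex[y xy]|nx] := pselect (continuous x); last by exists x.
    by exists y.
  by exists s.
pose X k := iter k s (cst z0).
have cX k : continuous (X k).
  elim: k => [|k IH]; first exact: cst_continuous.
  exact: picard_step_continuous (sE _ IH).
have XS k : picard_step (X k) (X k.+1) by exact: sE.
pose C := `|G z0| * T.
have XC k t : `|X k.+1 t - X k t| <= C / 2 ^+ k.
  elim: k t => [|k IH] t.
    rewrite expr0 divr1; have [F [F0 dF ->]] := XS 0; rewrite -[X 0 t]F0.
    exact: (@mean_value_bound R n F (fun=> G z0)).
  have := picard_step_contract (XS k.+1) (XS k) IH t.
  by rewrite exprSr invfM mulrA.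
have /choice[Y YE] t : exists l, forall k, `|X k t - l| <= 2 * C / 2 ^+ k.
  by apply: geometric_limit => k.
have cY : continuous Y.
  move=> t; apply/cvgrPdist_lt => e e0.
  have e3 : 0 < e / 3 by rewrite divr_gt0.
  have [k ke] := small_geometric (2 * C) e3.
  near=> r.
  have Xtr : `|X k t - X k r| < e / 3.
    by near: r; apply: cvgr_dist_lt => //; exact: cX.
  have := le_lt_trans (YE t k) ke; have := le_lt_trans (YE r k) ke.
  rewrite distrC in Xtr; rewrite [`|X k t - _|]distrC.
  have := ler_normD (Y t - X k t) (X k t - X k r).
  have := ler_normD (Y t - X k r) (X k r - Y r).
  rewrite !subrKA [`|X k t - _|]distrC; lra.
have [y Yy] := picard_step_ex cY.
(* By contraction [y] is within [C / 2 ^+ k] of [X k.+1], and so is [Y]; as [k] grows the two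
   coincide. *)
have yE : y = Y.
  apply/funext => t; apply/eqP; rewrite -subr_eq0 -normr_le0.
  apply/ler_addgt0Pl => e e0; rewrite addr0.
  have [k ke] := small_geometric (2 * C) e0.
  have := @picard_step_contract (X k) Y (X k.+1) y (2 * C / 2 ^+ k) (XS k) Yy
    (YE ^~ k) t.
  have := YE t k.+1; rewrite exprS invfM.
  have := ler_normD (y t - X k.+1 t) (X k.+1 t - Y t).
  rewrite subrKA [`|y t - X _ _|]distrC; move: ke.
  move: (2 ^+ k)^-1 => q; lra.
have [F [F0 dF yF]] := Yy; rewrite yE in yF.
exists T, Y; split => // [|t tT].
  by rewrite yF clampE ?F0// normr0 ltW.
(* For [|t| < T] the clamp is the identity near [t], so [Y] agrees there with the antiderivative
   [F]. *)
apply: near_eq_is_derive (dF t (ltW tT)).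
have nt : `|r| @[r --> t] --> `|t| by exact: norm_continuous.
have {}nt : \forall r \near t, `|r| < T by exact: cvgr_lt `|t| nt T tT.
by apply: filterS nt => r rT; rewrite yF clampE// ltW.
Unshelve. all: by end_near. Qed.

End Picard.

(** * Smooth maps and local solutions of differential equations *)

Section NearEq.
Context {R : realType} {V W : normedModType R}.

(** The first-order expansion of [f] at [x] is also one of [g], and an expansion determines the
    differential. *)
Lemma near_eq_differentiable (f g : V -> W) x :
  (\forall y \near x, f y = g y) -> differentiable f x -> differentiable g x.
Proof.
move=> fg fx; have fgx : f x = g x by exact: nbhs_singleton fg.
have dfc : continuous ('d f x) by exact: diff_continuous.
have gE : g \o shift x = cst (g x) + 'd f x +o_ 0 id.
  apply/eqaddoP => e e0.
  have := diff_locally fx; move=> /eqaddoP/(_ _ e0).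
  have fg0 : \forall h \near 0, f (h + x) = g (h + x).
    by rewrite (near_shift x); apply: filterS fg => h; rewrite /= sub0r subrK.
  apply: filterS2 fg0 => h fgh; rewrite /= in fgh *.
  by rewrite !fctE /= -fgx -fgh.
have dg : 'd g x = 'd f x :> (V -> W) by exact: diff_unique.
by apply/diff_locallyP; rewrite dg.
Qed.

Lemma near_eq_continuous (f g : V -> W) x :
  (\forall y \near x, f y = g y) -> {for x, continuous f} ->
  {for x, continuous g}.
Proof.
move=> fg fx; have fgx : f x = g x by exact: nbhs_singleton fg.
have : f @ x --> g x by rewrite -fgx; exact: fx.
apply: cvg_trans; apply: near_eq_cvg.
by apply: filterS fg => y.
Qed.

End NearEq.

Section SmoothOn.
Context {R : realType} {V W : normedModType R} (U : set V).
Hypothesis U_open : open U.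
Implicit Types f g : V -> W.

Lemma smooth_differentiable f x : smooth_on U f -> U x -> differentiable f x.
Proof. by move=> /(_ 1)[fd _] /fd. Qed.

Lemma smooth_derive f v : smooth_on U f -> smooth_on U (fun x => 'D_v f x).
Proof. by move=> fs k; have [_] := fs k.+1; exact. Qed.

Lemma smooth_continuous f x : smooth_on U f -> U x -> {for x, continuous f}.
Proof. by move=> /(_ 0) fc /fc. Qed.

Lemma open_near (x : V) : U x -> \forall y \near x, U y.
Proof. by move=> Ux; exact: open_nbhs_nbhs. Qed.

(** As [U] is open, agreement on [U] is agreement near each of its points. This allows rewriting
    with identities between derivatives that hold only on [U]. *)
Lemma eq_Ck k f g : {in U, f =1 g} -> Ck U k f -> Ck U k g.
Proof.
elim: k f g => [|k IH] f g fg /=.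
  move=> fc x Ux; apply: near_eq_continuous (fc _ Ux).
  by apply: filterS (open_near Ux) => y Uy; apply: fg; rewrite inE.
move=> [fd fD]; split=> [x Ux|v].
  apply: near_eq_differentiable (fd _ Ux).
  by apply: filterS (open_near Ux) => y Uy; apply: fg; rewrite inE.
apply: IH (fD v) => x /[!inE] Ux; apply: near_eq_derive.
by apply: filterS (open_near Ux) => y Uy; apply: fg; rewrite inE.
Qed.

End SmoothOn.

Section SmoothCoordinates.
Context {R : realType} {V : normedModType R} (U : set V).
Hypothesis U_open : open U.

Lemma derive_coord m n (M : V -> 'M[R]_(m, n)) x v i j :
  differentiable M x -> 'D_v (fun x => M x i j) x = ('D_v M x) i j.
Proof.
by move=> Md; rewrite derive_mx ?mxE//; exact: diff_derivable.
Qed.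

Lemma smooth_coord m n (M : V -> 'M[R]_(m, n)) i j :
  smooth_on U M -> smooth_on U (fun x => M x i j).
Proof.
move=> Ms k; elim: k M Ms => [|k IH] M Ms /=.
  move=> x Ux; apply: (@continuous_comp _ _ _ M (fun A => A i j)).
    exact: smooth_continuous Ux.
  exact: coord_continuous.
split=> [x Ux|v].
  apply: (@differentiable_comp _ _ _ _ M (fun A => A i j)).
    exact: smooth_differentiable Ux.
  exact: differentiable_coord.
apply: (eq_Ck U_open _ (IH _ (smooth_derive v Ms))) => x /[!inE] Ux.
by rewrite derive_coord//; exact: smooth_differentiable Ux.
Qed.

Lemma schwarz_smooth n (f : V -> 'rV[R]_n) x v w : smooth_on U f -> U x ->
  'D_w (fun y => 'D_v f y) x = 'D_v (fun y => 'D_w f y) x.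
Proof.
move=> fs Ux; apply/rowP => k.
have mixed a b : ('D_a (fun y => 'D_b f y) x) 0 k =
    'D_a (fun y => 'D_b (fun z => f z 0 k) y) x.
  rewrite -derive_coord; last exact: smooth_differentiable (smooth_derive _ fs) Ux.
  apply: near_eq_derive; apply: filterS (open_near U_open Ux) => y Uy.
  by rewrite derive_coord//; exact: smooth_differentiable Uy.
have fks := smooth_coord 0 k fs.
apply: etrans (mixed w v) _; apply: etrans _ (esym (mixed v w)).
apply: schwarz.
- apply: filterS (open_near U_open Ux) => y; exact: smooth_differentiable.
- apply: filterS (open_near U_open Ux) => y.
  exact: smooth_differentiable (smooth_derive _ fks).
- apply: filterS (open_near U_open Ux) => y.
  exact: smooth_differentiable (smooth_derive _ fks).
- exact: smooth_continuous (smooth_derive _ (smooth_derive _ fks)) Ux.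
- exact: smooth_continuous (smooth_derive _ (smooth_derive _ fks)) Ux.
Qed.

End SmoothCoordinates.

Lemma smooth_locally_lipschitz (R : realType) n (U : set 'rV[R]_n)
    (f : 'rV[R]_n -> R) x :
  open U -> U x -> smooth_on U f -> locally_lipschitz x f.
Proof.
move=> oU Ux fs; apply: C1_locally_lipschitz => [|v].
  by apply: filterS (open_near oU Ux) => y; exact: smooth_differentiable.
exact: smooth_continuous (smooth_derive _ fs) Ux.
Qed.

(** * Local solutions of first-order and second-order equations *)

Section LocalExistence.
Context {R : realType}.

Lemma picard_local n (G : 'rV[R]_n -> 'rV[R]_n) (z0 : 'rV[R]_n) :
  (forall i, locally_lipschitz z0 (fun y => G y 0 i)) ->
  exists (e : R) (X : R -> 'rV[R]_n), [/\ 0 < e, X 0 = z0 &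
    forall t : R, `|t| < e -> is_derive t 1 X (G (X t))].
Proof.
move=> Gl.
have /choice[L LE] i : exists L : R, 0 <= L /\ \forall z \near (z0, z0),
    `|G z.1 0 i - G z.2 0 i| <= L * `|z.1 - z.2|.
  by have [L L0 LE] := Gl i; exists L.
have : \forall z \near (z0, z0), forall i,
    `|G z.1 0 i - G z.2 0 i| <= L i * `|z.1 - z.2|.
  by near=> z; near: z; apply: filter_forall => i; exact: (LE i).2.
move=> /nbhs_ballP[d /= d0 dG].
(* Clamping the coordinates to a box around [z0] makes [G] globally Lipschitz. *)
pose K (z : 'rV[R]_n) : 'rV[R]_n :=
  \row_i clamp (z0 0 i - d / 2) (z0 0 i + d / 2) (z 0 i).
have Kz (z : 'rV[R]_n) : ball z0 d (K z).
  rewrite -ball_normE/=; apply: (@le_lt_trans _ _ (d / 2)); last lra.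
  apply: mx_norm_le => [|i j]; first lra.
  rewrite ord1 !mxE ler_norml.
  have := @clamp_itv R (z0 0 j - d / 2) (z0 0 j + d / 2) (z 0 j).
  by lra.
pose M := \sum_i L i.
have M0 : 0 <= M by apply: sumr_ge0 => i _; exact: (LE i).1.
have KG (y z : 'rV[R]_n) : `|G (K y) - G (K z)| <= M * `|y - z|.
  apply: mx_norm_le => [|i j]; first exact: mulr_ge0.
  have /(_ j) /= := dG (K y, K z) (conj (Kz y) (Kz z)).
  rewrite ord1 !mxE => /le_trans; apply.
  apply: ler_pM => //; first exact: (LE j).1.
    rewrite /M (bigD1 j)//= lerDl; apply: sumr_ge0 => k _; exact: (LE k).1.
  apply: mx_norm_le => // a b; rewrite !mxE.
  apply: le_trans (clamp_lipschitz _ _ _ _) _.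
  by have := coord_le_mx_norm (y - z) 0 b; rewrite !mxE.
have [e [X [e0 X0 dX]]] := @picard R n (G \o K) M z0 KG M0.
have cX : {for 0, continuous X}.
  apply/differentiable_continuous/derivable1_diffP.
  have /dX dX0 : `|0 : R| < e by rewrite normr0.
  exact: (@ex_derive _ _ _ _ _ _ _ dX0).
have d2 : 0 < d / 2 by rewrite divr_gt0.
have /cvgrPdist_lt/(_ _ d2)/nbhs_ballP[r /= r0 rX] := cX.
(* For [|t| < r] the solution has moved by less than [d / 2], so it is still in the box where [K] is
   the identity and [G \o K] equals [G]. *)
exists (Num.min e r), X; split => //; first by rewrite lt_min e0.
move=> t; rewrite lt_min => /andP[te tr]; have := dX t te.
have -> // : (G \o K) (X t) = G (X t).
congr (G _); apply/rowP => i; rewrite mxE clamp_id//.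
have : `|X 0 - X t| < d / 2 by apply: rX; rewrite -ball_normE/= sub0r normrN.
move=> /ltW/(le_trans (coord_le_mx_norm _ 0 i)).
by rewrite X0 !mxE ler_norml; lra.
Unshelve. all: by end_near. Qed.

Lemma norm_lsubmx_le n k (z : 'rV[R]_(n + k)) : `|lsubmx z| <= `|z|.
Proof. by apply: mx_norm_le => // i j; rewrite mxE; exact: coord_le_mx_norm. Qed.

(** The equation becomes the first-order system [(x, v)' = (v, F x v)] for the concatenated vector
    of position and velocity. *)
Lemma second_order_ode n (F : 'rV[R]_n -> 'rV[R]_n -> 'rV[R]_n) x0 v0 :
  (forall i, locally_lipschitz (row_mx x0 v0)
    (fun z => F (lsubmx z) (rsubmx z) 0 i)) ->
  exists (e : R) (x : R -> 'rV[R]_n), [/\ 0 < e, x 0 = x0,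
    is_derive (0 : R) 1 x v0 &
    forall t : R, `|t| < e -> is_derive t 1 x ((x^`())%classic t) /\
      is_derive t 1 (x^`())%classic (F (x t) ((x^`())%classic t))].
Proof.
move=> Fl; pose G (z : 'rV[R]_(n + n)) := row_mx (rsubmx z) (F (lsubmx z) (rsubmx z)).
have [|e [X [e0 X0 dX]]] := @picard_local _ G (row_mx x0 v0).
  move=> i; case: (split_ordP i) => j ->; rewrite /G.
    under eq_fun do rewrite row_mxEl mxE; exact: locally_lipschitz_coord.
  by under eq_fun do rewrite row_mxEr; exact: Fl.
pose x (t : R) := lsubmx (X t); pose v (t : R) := rsubmx (X t).
have dx (t : R) : `|t| < e -> is_derive t 1 x (v t).
  move=> /dX /is_derive_mxP dXt; apply/is_derive_mxP => i j.
  have := dXt i (lshift n j); rewrite /G row_mxEl.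
  by under [in X in _ -> X]eq_fun do rewrite /x mxE.
have dv (t : R) : `|t| < e -> is_derive t 1 v (F (x t) (v t)).
  move=> /dX /is_derive_mxP dXt; apply/is_derive_mxP => i j.
  have := dXt i (rshift n j); rewrite /G row_mxEr.
  by under [in X in _ -> X]eq_fun do rewrite /v mxE.
have xv (t : R) : `|t| < e -> (x^`())%classic t = v t.
  by move=> te; exact: is_derive1E (dx t te).
have ee (t : R) : `|t| < e -> \forall r \near t, `|r| < e.
  move=> te; have nt : `|r| @[r --> t] --> `|t| by exact: norm_continuous.
  exact: cvgr_lt `|t| nt e te.
exists e, x; split; first exact: e0.
- by rewrite /x X0 row_mxKl.
- by have := dx 0; rewrite normr0 /v X0 row_mxKr; apply.
- move=> t te; rewrite xv//; split; first exact: dx.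
  apply: near_eq_is_derive (dv t te).
  by apply: filterS (ee t te) => r re; rewrite xv.
Qed.

End LocalExistence.

(** * The geodesic equation and changes of charts *)

Section EulerLagrange.
Context {R : realType} {n : nat}.
Implicit Types (h : 'rV[R]_n -> 'M[R]_n) (u v a : 'rV[R]_n).

(* The quadratic Christoffel term of the geodesic equation with its index
   lowered by the metric [h]. *)
Definition geodesic_force h u v : 'rV[R]_n :=
  v *m 'D_v h u -
  2^-1 *: \row_l (v *m 'D_(delta_mx 0 l) h u *m v^T) 0 0.

Lemma derive_mulmx_delta h u v w i j : differentiable h u ->
  ('D_w h u) i j = \sum_l w 0 l * ('D_(delta_mx 0 l) h u) i j.
Proof.
move=> hd; rewrite derive_sum_delta// summxE.
by apply: eq_bigr => l _; rewrite mxE.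
Qed.

(** Contracted twice with [v], the first two derivative terms of the Christoffel symbol coincide
    after exchanging the indices, so with the factor 1/2 they form [v *m 'D_v h u]. The transpose
    comes from the matrix acting on row vectors from the right. *)
Lemma christoffelE (P : manifold R n) (g : riemannian_metric P)
    (c : chart R n P) u v k :
  differentiable (metric g c) u ->
  \sum_i \sum_j christoffel g c u i j k * v 0 i * v 0 j =
  (geodesic_force (metric g c) u v *m (invmx (metric g c u))^T) 0 k.
Proof.
move=> hd; set h := metric g c in hd *.
have pE i j l : partial i (fun y => h y j l) u = ('D_(delta_mx 0 i) h u) j l.
  exact: derive_coord.
rewrite mxE; under [RHS]eq_bigr do rewrite [(invmx _)^T _ _]mxE.
pose D i j l := ('D_(delta_mx 0 i) h u) j l.
have qE l : geodesic_force h u v 0 l =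
    \sum_i \sum_j 2^-1 * (D i j l + D j i l - D l i j) * v 0 i * v 0 j.
  rewrite /geodesic_force !mxE.
  have -> : \sum_j v 0 j * ('D_v h u) j l = \sum_i \sum_j D i j l * v 0 i * v 0 j.
    rewrite exchange_big /=; apply: eq_bigr => j _.
    rewrite derive_mulmx_delta// mulr_sumr; apply: eq_bigr => i _.
    by rewrite /D; ring.
  have -> : \sum_j (v *m 'D_(delta_mx 0 l) h u) 0 j * v^T j 0 =
      \sum_i \sum_j D l i j * v 0 i * v 0 j.
    rewrite exchange_big /=; apply: eq_bigr => j _.
    rewrite !mxE mulr_suml; apply: eq_bigr => i _.
    by rewrite /D; ring.
  have sw : \sum_i \sum_j D j i l * v 0 i * v 0 j =
      \sum_i \sum_j D i j l * v 0 i * v 0 j.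
    by rewrite exchange_big; apply: eq_bigr => i _; apply: eq_bigr => j _; ring.
  have -> : \sum_i \sum_j 2^-1 * (D i j l + D j i l - D l i j) * v 0 i * v 0 j =
      2^-1 * (\sum_i \sum_j D i j l * v 0 i * v 0 j) +
      2^-1 * (\sum_i \sum_j D j i l * v 0 i * v 0 j) -
      2^-1 * (\sum_i \sum_j D l i j * v 0 i * v 0 j).
    rewrite !mulr_sumr -big_split -sumrB; apply: eq_bigr => i _.
    rewrite !mulr_sumr -big_split -sumrB; apply: eq_bigr => j _.
    by rewrite /=; ring.
  by rewrite sw; field.
under [RHS]eq_bigr do rewrite qE mulr_suml.
rewrite [RHS]exchange_big /=; apply: eq_bigr => i _.
under [RHS]eq_bigr do rewrite mulr_suml.
rewrite [RHS]exchange_big /=; apply: eq_bigr => j _.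
rewrite /christoffel -!mulrA mulrCA mulr_suml.
by apply: eq_bigr => l _; rewrite !pE /D -/h; ring.
Qed.

(** A nonzero vector in the kernel would have length zero, against positivity. *)
Lemma metric_unitmx (P : manifold R n) (g : riemannian_metric P)
    (c : chart R n P) u :
  atlas c -> cod c u -> metric g c u \in unitmx.
Proof.
move=> ac cu; rewrite -row_free_unit -kermx_eq0; apply/eqP/row_matrixP => i.
rewrite row0; apply/eqP/negPn/negP => Xn0.
have := metric_pos g ac cu Xn0.
by rewrite -row_mul mulmx_ker row0 mul0mx mxE ltxx.
Qed.

(** Multiplication by the invertible Gram matrix lowers the index of the geodesic equation. The
    resulting form contains no inverse matrix and is the one compared between charts. *)
Lemma geodesic_equationE (P : manifold R n) (g : riemannian_metric P)
    (c : chart R n P) u v a : atlas c -> cod c u ->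
  (forall k, a 0 k + \sum_i \sum_j christoffel g c u i j k * v 0 i * v 0 j = 0)
  <-> a *m metric g c u + geodesic_force (metric g c) u v = 0.
Proof.
move=> ac cu.
have hd : differentiable (metric g c) u.
  exact: smooth_differentiable (metric_smooth g ac) cu.
have hu := metric_unitmx g ac cu.
have -> : (forall k, a 0 k + \sum_i \sum_j christoffel g c u i j k * v 0 i * v 0 j = 0)
    <-> a + geodesic_force (metric g c) u v *m invmx (metric g c u) = 0.
  have iT : (invmx (metric g c u))^T = invmx (metric g c u).
    by rewrite trmx_inv (Defs.metric_sym g ac cu).
  split=> [E|E k].
    by apply/rowP => k; have := E k; rewrite christoffelE// iT !mxE.
  by rewrite christoffelE// iT; move/rowP/(_ k) : E; rewrite !mxE.
split=> [/(congr1 (mulmx^~ (metric g c u)))|/(congr1 (mulmx^~ (invmx (metric g c u))))].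
  by rewrite mulmxDl mulmxKV// mul0mx.
by rewrite mulmxDl mulmxK// mul0mx.
Qed.

End EulerLagrange.

Section JacobianDerivative.
Context {R : realType} {n m : nat} (W : set 'rV[R]_n) (f : 'rV[R]_n -> 'rV[R]_m).
Hypotheses (W_open : open W) (f_smooth : smooth_on W f).
Implicit Types u v w : 'rV[R]_n.

(* [v *m jacobian_derivative f u w] is the second derivative of [f] at [u] in
   the directions [v] and [w]. *)
Definition jacobian_derivative u w : 'M[R]_(n, m) :=
  \matrix_(i, k) ('D_w (fun y => 'D_(delta_mx 0 i) f y) u) 0 k.

Let f_diff u : W u -> differentiable f u.
Proof. exact: smooth_differentiable f_smooth. Qed.

Let df_diff v u : W u -> differentiable (fun y => 'D_v f y) u.
Proof. exact: smooth_differentiable (smooth_derive v f_smooth). Qed.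

(** The rows of the Jacobian are derivatives along basis vectors wherever [f] is differentiable;
    continuity of [x] keeps [x r] in the open set [W] for [r] near [t]. *)
Lemma is_derive_jacobian (V : normedModType R) (x : V -> 'rV[R]_n) (t d : V)
    (dx : 'rV[R]_n) :
  is_derive t d x dx -> {for t, continuous x} -> W (x t) ->
  is_derive t d (fun r => jacobian f (x r)) (jacobian_derivative (x t) dx).
Proof.
move=> xd xc Wx; apply/is_derive_mxP => i k; rewrite mxE.
apply: (@near_eq_is_derive _ _ _ (fun r => ('D_(delta_mx 0 i) f (x r)) 0 k)).
  have : \forall r \near t, W (x r) by apply: xc; exact: open_near W_open _ Wx.
  apply: filterS => r Wr.
  by rewrite (deriveEjacobian _ (f_diff Wr)) -rowE [LHS]mxE.
have := @is_derive_comp_diff _ _ _ _ x (fun y => 'D_(delta_mx 0 i) f y) t d dx xd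
  (df_diff _ Wx).
by move=> /is_derive_mxP/(_ 0 k).
Qed.

Lemma mulmx_jacobian_derivative u v w : W u ->
  v *m jacobian_derivative u w = 'D_w (fun y => 'D_v f y) u.
Proof.
move=> Wu; apply/rowP => k; rewrite mxE -(derive_coord _ _ _ (df_diff _ Wu)).
have E : \forall y \near u, (\sum_i v 0 i * ('D_(delta_mx 0 i) f y) 0 k) =
    ('D_v f y) 0 k.
  apply: filterS (open_near W_open Wu) => y Wy.
  rewrite (derive_sum_delta _ (f_diff Wy)) summxE.
  by apply: eq_bigr => i _; rewrite mxE.
rewrite -(near_eq_derive _ E).
apply/esym; apply: (@derive_val _ _ _ _ _ _ _ (_ : is_derive u w _ _)).
apply: is_derive_sumT => i; rewrite mxE.
have di : is_derive u w (fun y => 'D_(delta_mx 0 i) f y 0 k)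
    ('D_w (fun y => 'D_(delta_mx 0 i) f y) u 0 k).
  have /is_derive_mxP := diff_is_derive w (df_diff (delta_mx 0 i) Wu).
  exact.
have := is_derive_mul (is_derive_cst (v 0 i) u w) di.
by rewrite mul0r add0r.
Qed.

Lemma jacobian_derivative_sym u v w : W u ->
  v *m jacobian_derivative u w = w *m jacobian_derivative u v.
Proof.
move=> Wu; rewrite (mulmx_jacobian_derivative v w Wu).
rewrite (mulmx_jacobian_derivative w v Wu).
exact: (schwarz_smooth W_open v w f_smooth Wu).
Qed.

End JacobianDerivative.

(** * Covariance of the geodesic equation *)

Section ChartChange.
Context {R : realType} {n : nat} {P : manifold R n} (g : riemannian_metric P).
Context (c c' : chart R n P) (ac : atlas c) (ac' : atlas c').

Let W := cod c `&` param c @^-1` dom c'.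
Let phi := coords c' \o param c.
Let h := metric g c.
Let h' := metric g c'.

Lemma open_overlap : open W.
Proof.
rewrite openE => u [cu du]; apply: filterI.
  exact: open_nbhs_nbhs (conj (@cod_open _ _ _ c) cu).
apply: (param_continuous cu).
exact: open_nbhs_nbhs (conj (@dom_open _ _ _ c') du).
Qed.

Let phi_smooth : smooth_on W phi.
Proof. exact: atlas_compatible. Qed.

Let phi_diff u : W u -> differentiable phi u.
Proof. exact: smooth_differentiable phi_smooth. Qed.

Let A u := jacobian phi u.
Let dA u w := jacobian_derivative phi u w.

Let hE u : W u -> h u = A u *m h' (phi u) *m (A u)^T.
Proof.
move=> [cu du]; have := metric_compatible g ac ac' (param_dom cu) du.
by rewrite (paramK cu).
Qed.

Let codphi u : W u -> cod c' (phi u).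
Proof. by move=> [_ du]; exact: coords_cod. Qed.

Let dh u w : W u -> 'D_w h u =
  (dA u w *m h' (phi u) + A u *m 'D_(w *m A u) h' (phi u)) *m (A u)^T
  + A u *m h' (phi u) *m (dA u w)^T.
Proof.
move=> Wu; apply: (@derive_val _ _ _ _ _ _ _ (_ : is_derive u w _ _)).
apply: (@near_eq_is_derive _ _ _ (fun y => A y *m h' (phi y) *m (A y)^T)).
  by apply: filterS (open_near open_overlap Wu) => y Wy; rewrite hE.
have dAu : is_derive u w A (dA u w).
  have uc : {for u, continuous (@idfun 'rV[R]_n)} by exact: cvg_id.
  exact: (is_derive_jacobian open_overlap phi_smooth (is_derive_id u w) uc Wu).
apply: is_derive_mulmx; last exact: is_derive_trmx.
apply: is_derive_mulmx.
rewrite -(deriveEjacobian _ (phi_diff Wu)).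
apply: (@is_derive_comp_diff _ _ _ _ phi h').
  exact: diff_is_derive (phi_diff Wu).
exact: smooth_differentiable (metric_smooth g ac') (codphi Wu).
Qed.

(** Differentiating [h = A h' A^T] along [v] produces the unwanted term [v' *m H *m B^T], where [B]
    is the derivative of [A] along [v]. The gradient of the quadratic form, halved, contains the
    same term, and the difference removes it. *)
Lemma euler_lagrange_chart_change u v a : W u ->
  a *m h u + geodesic_force h u v =
  ((a *m A u + v *m dA u v) *m h' (phi u) +
   geodesic_force h' (phi u) (v *m A u)) *m (A u)^T.
Proof.
move=> Wu; have h'T := Defs.metric_sym g ac' (codphi Wu); rewrite -/h' in h'T.
set v' := v *m A u; set H := h' (phi u) in h'T *.
have h'd := smooth_differentiable (metric_smooth g ac') (codphi Wu).
set B := dA u v; set Q := \row_l (v' *m 'D_(delta_mx 0 l) h' (phi u) *m v'^T) 0 0.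
(* Symmetry of second derivatives turns [v *m dA u e] into [e *m B]; as [H] is symmetric, the two
   terms in which [A] is differentiated are equal, whence the factor 2. *)
have QE : \row_l (v *m 'D_(delta_mx 0 l) h u *m v^T) 0 0 =
    2 *: (v' *m H *m B^T) + Q *m (A u)^T.
  apply/rowP => l; rewrite [LHS]mxE; pose e : 'rV[R]_n := delta_mx 0 l.
  rewrite -/e.
  have -> : v *m 'D_e h u *m v^T = v *m dA u e *m H *m v'^T +
      v' *m 'D_(e *m A u) h' (phi u) *m v'^T + v' *m H *m (v *m dA u e)^T.
    by rewrite dh// -/H /v' !trmx_mul !(mulmxDr, mulmxDl) !mulmxA.
  have eE (Y : 'rV[R]_n) : (Y *m e^T) 0 0 = Y 0 l.
    by rewrite trmx_delta -colE mxE.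
  rewrite /dA (jacobian_derivative_sym open_overlap phi_smooth) -/B// mxE [X in X + _]mxE.
  have -> : e *m B *m H *m v'^T = (v' *m H *m B^T *m e^T)^T.
    by rewrite !trmx_mul !trmxK h'T !mulmxA.
  rewrite [_^T 0 0]mxE eE (trmx_mul e B) (mulmxA _ B^T) eE.
  have -> : (v' *m 'D_(e *m A u) h' (phi u) *m v'^T) 0 0 = (Q *m (A u)^T) 0 l.
    rewrite derive_sum_delta// mulmx_sumr mulmx_suml summxE [RHS]mxE.
    apply: eq_bigr => k _; rewrite -scalemxAr -scalemxAl mxE -rowE !mxE.
    by rewrite mulrC.
  by rewrite [RHS]mxE [X in _ = X + _]mxE; ring.
rewrite /geodesic_force QE -/Q dh// -/H -/B -/v' hE// -/H.
rewrite !(mulmxDr, mulmxDl, mulNmx, mulmxN) !scalerDr scalerA mulVf// scale1r.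
rewrite -!scalemxAl !mulmxA -/v' opprD !addrA.
by rewrite addrK.
Qed.

Lemma geodesic_chart_change (x : R -> 'rV[R]_n) (t : R) a : W (x t) ->
  (\forall r \near t, derivable x r 1) ->
  is_derive t 1 (x^`())%classic a ->
  a *m h (x t) + geodesic_force h (x t) ((x^`())%classic t) = 0 ->
  let y := phi \o x in
  (\forall r \near t, derivable y r 1) /\
  exists b, is_derive t 1 (y^`())%classic b /\
    b *m h' (y t) + geodesic_force h' (y t) ((y^`())%classic t) = 0.
Proof.
move=> Wx dx ddx xE y.
have x't r : derivable x r 1 -> is_derive r 1 x ((x^`())%classic r).
  by move=> xr; rewrite derive1E; exact: derivableP.
have dxt := nbhs_singleton dx.
have xc : {for t, continuous x}.
  exact/differentiable_continuous/derivable1_diffP.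
have dy : \forall r \near t, is_derive (r : R) 1 y ((x^`())%classic r *m A (x r)).
  have Wr : \forall r \near t, W (x r) by apply: xc; exact: open_near open_overlap _ Wx.
  apply: filterS2 dx Wr => r xr Wr.
  rewrite -(deriveEjacobian _ (phi_diff Wr)).
  exact: is_derive_comp_diff (x't r xr) (phi_diff Wr).
have y'E : \forall r \near t, (x^`())%classic r *m A (x r) = (y^`())%classic r.
  by apply: filterS dy => r yr; exact: esym (is_derive1E yr).
split; first by apply: filterS dy => r yr; exact: (@ex_derive _ _ _ _ _ _ _ yr).
(* The witness is the second derivative of [phi \o x] given by the product and chain rules. *)
exists (a *m A (x t) + (x^`())%classic t *m dA (x t) ((x^`())%classic t)); split.
  apply: near_eq_is_derive y'E _.
  apply: is_derive_mulmx.
  exact: is_derive_jacobian open_overlap phi_smooth _ _ _ _ _ (x't t dxt) xc Wx.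
rewrite -(nbhs_singleton y'E).
have := euler_lagrange_chart_change ((x^`())%classic t) a Wx.
(* The factor [A^T] can be cancelled: [A] is invertible because the Gram matrix [A h' A^T] is. *)
rewrite xE => /esym/(congr1 (mulmx^~ (invmx (A (x t))^T))).
rewrite mulmxK ?mul0mx// unitmx_tr.
have := metric_unitmx g ac (Wx.1); rewrite -/h (hE Wx) !unitmx_mul.
by case/andP => /andP[].
Qed.

End ChartChange.

(** * Geodesics and geodesic symmetries *)

Section GeodesicExistence.
Context {R : realType} {n : nat} {P : manifold R n} (g : riemannian_metric P).

Lemma christoffel_locally_lipschitz (c : chart R n P) u i j k :
  atlas c -> cod c u ->
  locally_lipschitz u (fun y => christoffel g c y i j k).
Proof.
move=> ac cu; have oc := @cod_open _ _ _ c.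
have hs a b : smooth_on (cod c) (fun y => metric g c y a b).
  by apply: smooth_coord; [exact: oc|exact: metric_smooth].
have hl a b : locally_lipschitz u (fun y => metric g c y a b).
  exact: smooth_locally_lipschitz oc cu (hs a b).
have pl a b d : locally_lipschitz u (partial d (fun y => metric g c y a b)).
  exact: smooth_locally_lipschitz oc cu (smooth_derive _ (hs a b)).
apply: locally_lipschitzM; first exact: locally_lipschitz_cst.
apply: locally_lipschitz_sum => l; apply: locally_lipschitzM.
  exact: locally_lipschitz_invmx (metric_unitmx g ac cu) hl.
apply: locally_lipschitzD; last exact/locally_lipschitzN/pl.
exact: locally_lipschitzD.
Qed.

Lemma geodesic_exists (c : chart R n P) (p : P) (v : 'rV[R]_n) :
  atlas c -> dom c p -> exists (e : R) (gam : R -> P),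
    [/\ 0 < e, geodesic g e gam, gam 0 = p &
        is_derive (0 : R) 1 (coords c \o gam) v].
Proof.
move=> ac dp; have cp := coords_cod dp.
pose F (u w : 'rV[R]_n) : 'rV[R]_n :=
  - \row_k \sum_i \sum_j christoffel g c u i j k * w 0 i * w 0 j.
have [|e [x [e0 x0 dx0 dx]]] := @second_order_ode R n F (coords c p) v.
  move=> k; under eq_fun do rewrite !mxE.
  apply: locally_lipschitzN; apply: locally_lipschitz_sum => i.
  apply: locally_lipschitz_sum => j.
  have cl a : locally_lipschitz (row_mx (coords c p) v) (fun z => rsubmx z 0 a).
    by under eq_fun do rewrite mxE; exact: locally_lipschitz_coord.
  apply: locally_lipschitzM => //; apply: locally_lipschitzM => //.
  apply: (@locally_lipschitz_comp _ _ _ _ (fun y => christoffel g c y i j k) lsubmx).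
    by move=> y z; rewrite -linearB; exact: norm_lsubmx_le.
  by rewrite row_mxKl; exact: christoffel_locally_lipschitz.
have xc (t : R) : `|t| < e -> {for t, continuous x}.
  move=> te; apply/differentiable_continuous/derivable1_diffP.
  exact: (@ex_derive _ _ _ _ _ _ _ (dx t te).1).
have xcod : \forall t \near (0 : R), cod c (x t).
  apply: (xc 0); first by rewrite normr0.
  by rewrite x0; exact: open_near (@cod_open _ _ _ c) _ cp.
have /nbhs_ballP[r /= r0 xr] := xcod.
have {}xr (t : R) : `|t| < r -> cod c (x t).
  by move=> tr; apply: xr; rewrite -ball_normE/= sub0r normrN.
(* The bound [r] keeps [x] inside [cod c], outside of which [param c] is meaningless. The equation
   solved in [c] is then carried to each chart [c']. *)
exists (Num.min e r), (param c \o x); split.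
- by rewrite lt_min e0.
- move=> t; rewrite lt_min => /andP[te tr]; split.
    by apply: continuous_comp; [exact: xc|exact: param_continuous (xr t tr)].
  move=> c' ac' dt.
  have [||||yd [b [db bE]]] := @geodesic_chart_change R n P g c c' ac ac' x t
      (F (x t) ((x^`())%classic t)).
  + by split; [exact: xr|].
  + have nt : `|s| @[s --> t] --> `|t| by exact: norm_continuous.
    have {}nt : \forall s \near t, `|s| < e by exact: cvgr_lt `|t| nt e te.
    apply: filterS nt => s se; exact: (@ex_derive _ _ _ _ _ _ _ (dx s se).1).
  + exact: (dx t te).2.
  + apply/(geodesic_equationE g _ _ ac (xr t tr)) => k.
    by rewrite !mxE addNr.
  split; [exact: yd|exact: (@ex_derive _ _ _ _ _ _ _ db)|move=> k].
  have -> : ((coords c' \o (param c \o x))^`()^`())%classic t = b.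
    exact: is_derive1E db.
  move: k; apply/(geodesic_equationE g _ _ ac') => //.
  exact: coords_cod.
- by rewrite /= x0 coordsK.
- apply: near_eq_is_derive dx0.
  by apply: filterS xcod => t ct; rewrite /= paramK.
Qed.

(** For a geodesic with initial velocity [v], differentiating [s (gam t) = gam (- t)] at 0 gives [v]
    times the Jacobian on the left and [- v] on the right. *)
Lemma symmetry_jacobian (c : chart R n P) (p : P) (s : P -> P) :
  atlas c -> dom c p -> geodesic_symmetry g p s ->
  jacobian (local_map c c s) (coords c p) = - 1%:M.
Proof.
move=> ac dp [[[sc ss] _] sp srev].
suff H (v : 'rV[R]_n) : v *m jacobian (local_map c c s) (coords c p) = - v.
  by apply/row_matrixP => i; rewrite !rowE H mulmxN mulmx1.
have [e [gam [e0 gamg gam0 dy]]] := geodesic_exists v ac dp.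
have sd : differentiable (local_map c c s) (coords c p).
  apply: smooth_differentiable (ss c c ac ac) _.
  by split; [exact: coords_cod|rewrite /= coordsK// sp].
set y := coords c \o gam in dy.
have y0 : y 0 = coords c p by rewrite /y /= gam0.
have yd : differentiable y 0.
  by apply/derivable1_diffP; exact: (@ex_derive _ _ _ _ _ _ _ dy).
have d1 : is_derive (0 : R) 1 (local_map c c s \o y)
    (v *m jacobian (local_map c c s) (coords c p)).
  by rewrite -deriveEjacobian// -y0; apply: is_derive_comp_diff; rewrite ?y0.
have d2 : is_derive (0 : R) 1 (y \o -%R) (- v).
  have yN : differentiable y (- 0) by rewrite oppr0.
  have := @is_derive_comp_diff _ _ _ _ (-%R) y (0 : R) 1 (- 1)
    (is_deriveNid _ _) yN.
  rewrite deriveE// linearN oppr0 -deriveE//.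
  by rewrite (@derive_val _ _ _ _ _ _ _ dy).
(* Continuity of [gam] at 0 keeps it in [dom c] for small times, where [param c] inverts
   [coords c]. *)
have E : \forall t \near (0 : R), (local_map c c s \o y) t = (y \o -%R) t.
  have g0 : `|0 : R| < e by rewrite normr0.
  have gd : \forall t \near (0 : R), dom c (gam t).
    apply: (gamg 0 g0).1; rewrite gam0.
    exact: open_nbhs_nbhs (conj (@dom_open _ _ _ c) dp).
  apply: filterS2 (nbhsx_ballx 0 e e0) gd => t.
  rewrite -ball_normE/= sub0r normrN => te dt.
  by rewrite /local_map /y /= coordsK// (srev e gam).
have d3 := near_eq_is_derive E d1.
by rewrite -(@derive_val _ _ _ _ _ _ _ d3) (@derive_val _ _ _ _ _ _ _ d2).
Qed.

End GeodesicExistence.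

(** * The second fundamental form of an equivariant embedding *)

Section OrthogonalProjection.
Context {R : realType} {m : nat}.

Lemma mulmx_tr_eq0 k (X : 'M[R]_(k, m)) : X *m X^T = 0 -> X = 0.
Proof.
move=> X0; apply/matrixP => i j; rewrite mxE; apply/eqP.
move/matrixP/(_ i i) : X0; rewrite !mxE => /eqP.
rewrite psumr_eq0 => [/allP/(_ j)|l _]; last by rewrite mxE -expr2 sqr_ge0.
by rewrite mem_index_enum mxE -expr2 sqrf_eq0 => /(_ isT).
Qed.

Lemma sub_orthocompl k l (U : 'M[R]_(k, m)) (X : 'M[R]_(l, m)) :
  (X <= orthocompl U)%MS = (X *m U^T == 0).
Proof. exact: sub_kermx. Qed.

(** The intersection has the form [Z *m U] and is annihilated by [U^T], so its product with its own
    transpose vanishes. *)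
Lemma cap_orthocompl (U : 'M[R]_m) : (U :&: orthocompl U = 0)%MS.
Proof.
apply: mulmx_tr_eq0; have /submxP[Z {2}->] := capmxSl U (orthocompl U).
have := capmxSr U (orthocompl U); rewrite sub_orthocompl => /eqP X0.
by rewrite trmx_mul mulmxA X0 mul0mx.
Qed.

Lemma orthocompl_full k (U : 'M[R]_m) (X : 'M[R]_(k, m)) :
  (X <= U + orthocompl U)%MS.
Proof.
apply: submx_full; rewrite /row_full mxrank_disjoint_sum ?cap_orthocompl//.
by rewrite mxrank_ker mxrank_tr subnKC// rank_leq_col.
Qed.

Lemma orthoprojP (U : 'M[R]_m) (w : 'rV[R]_m) y :
  (y <= U)%MS -> (w - y <= orthocompl U)%MS -> w *m orthoproj U = y.
Proof.
move=> yU wy; rewrite -(subrK y w) mulmxDl /orthoproj.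
by rewrite proj_mx_0 ?cap_orthocompl// proj_mx_id ?cap_orthocompl// add0r.
Qed.

(** The relation [D *m F = A *m D] with [A] invertible says that [F] maps the row space of [D] onto
    itself. Being orthogonal, [F] then preserves the complement [N] and the complement of [N], hence
    commutes with the projection onto [N]. *)
Lemma orthoproj_orthogonal k (D : 'M[R]_(k, m)) (A : 'M[R]_k) (F : 'M[R]_m)
    (w : 'rV[R]_m) : F *m F^T = 1%:M -> A \in unitmx -> D *m F = A *m D ->
  w *m F *m orthoproj (orthocompl D) = w *m orthoproj (orthocompl D) *m F.
Proof.
move=> FF Au DF; set N := orthocompl D.
have DFT : D *m F^T = invmx A *m D.
  by rewrite -[D in LHS](mulKmx Au) -DF -!mulmxA FF mulmx1.
have NF (y : 'rV[R]_m) : (y <= N)%MS -> (y *m F <= N)%MS.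
  rewrite !sub_orthocompl => /eqP yD.
  by rewrite -mulmxA -[F]trmxK -trmx_mul DFT trmx_mul mulmxA yD mul0mx.
(* Invariance of [N] under the adjoint [F^T] is what makes the complement of [N] invariant under
   [F]. *)
have NFN : (N *m F^T <= N)%MS.
  have : (N <= N)%MS by [].
  rewrite !sub_orthocompl => /eqP ND.
  by rewrite -mulmxA -trmx_mul DF trmx_mul mulmxA ND mul0mx.
have N'F (y : 'rV[R]_m) : (y <= orthocompl N)%MS -> (y *m F <= orthocompl N)%MS.
  have /submxP[Z NZ] := NFN.
  rewrite !sub_orthocompl => /eqP yN.
  by rewrite -mulmxA -[F]trmxK -trmx_mul NZ trmx_mul mulmxA yN mul0mx.
apply: orthoprojP; first by apply: NF; exact: proj_mx_sub.
rewrite -mulmxBl; apply: N'F.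
by apply: proj_mx_compl_sub; exact: orthocompl_full.
Qed.

Lemma orthoproj_orthocompl_row k (D : 'M[R]_(k, m)) (X : 'rV[R]_k) :
  X *m D *m orthoproj (orthocompl D) = 0.
Proof.
apply: orthoprojP; first exact: sub0mx.
rewrite subr0 sub_orthocompl.
have -> : X *m D *m (orthocompl D)^T = X *m (orthocompl D *m D^T)^T.
  by rewrite [in RHS]trmx_mul trmxK mulmxA.
by rewrite mulmx_ker trmx0 mulmx0.
Qed.

End OrthogonalProjection.

(** * Second derivatives of an equivariant map at a fixed point *)

Section EquivariantSecondDerivative.
Context {R : realType} {n m : nat} (U V : set 'rV[R]_n).
Context (F : 'rV[R]_n -> 'rV[R]_m) (phi : 'rV[R]_n -> 'rV[R]_n) (M : 'M[R]_m).
Hypotheses (U_open : open U) (V_open : open V).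
Hypotheses (F_smooth : smooth_on V F) (phi_smooth : smooth_on U phi).
Hypothesis phiV : forall y, U y -> V (phi y).
Hypothesis phiF : forall y, U y -> F (phi y) = F y *m M.

Lemma derive_equivariant y v : U y -> V y ->
  'D_v F y *m M = 'D_v phi y *m jacobian F (phi y).
Proof.
move=> Uy Vy.
have Fd z : V z -> differentiable F z by exact: smooth_differentiable F_smooth.
have pd : differentiable phi y by exact: smooth_differentiable phi_smooth Uy.
rewrite -(deriveEjacobian _ (Fd _ (phiV Uy))).
have d1 := is_derive_comp_diff (diff_is_derive v pd) (Fd _ (phiV Uy)).
have d2 := is_derive_mulmx (diff_is_derive v (Fd _ Vy)) (is_derive_cst M y v).
rewrite mulmx0 addr0 in d2.
rewrite -(@derive_val _ _ _ _ _ _ _ d2) -(@derive_val _ _ _ _ _ _ _ d1).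
apply: near_eq_derive; apply: filterS (open_near U_open Uy) => z Uz.
by rewrite /= phiF.
Qed.

(** The identity of [derive_equivariant] holds near [u] and is differentiated once more. The last
    term, carrying the second derivative of [phi], lies in the row space of the Jacobian of [F]: it
    is tangent and vanishes under the normal projection. *)
Lemma second_derive_equivariant u v w : U u -> V u -> phi u = u ->
  'D_w (fun y => 'D_v F y) u *m M =
  'D_('D_w phi u) (fun y => 'D_('D_v phi u) F y) u +
  'D_w (fun y => 'D_v phi y) u *m jacobian F u.
Proof.
move=> Uu Vu uu.
have pd : differentiable phi u by exact: smooth_differentiable phi_smooth Uu.
have d1 := is_derive_mulmx
  (diff_is_derive w (smooth_differentiable (smooth_derive v F_smooth) Vu))
  (is_derive_cst M u w).
rewrite mulmx0 addr0 in d1.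
have pc : {for u, continuous phi} by exact: differentiable_continuous.
have d2 := is_derive_mulmx
  (diff_is_derive w (smooth_differentiable (smooth_derive v phi_smooth) Uu))
  (is_derive_jacobian V_open F_smooth (diff_is_derive w pd) pc (phiV Uu)).
rewrite uu (mulmx_jacobian_derivative V_open F_smooth _ _ Vu) addrC in d2.
rewrite -(@derive_val _ _ _ _ _ _ _ d1) -(@derive_val _ _ _ _ _ _ _ d2).
apply: near_eq_derive.
apply: filterS2 (open_near U_open Uu) (open_near V_open Vu) => y Uy Vy.
exact: derive_equivariant.
Qed.

End EquivariantSecondDerivative.

(** Only the left vector enters in a visibly linear way; the symmetry moves scalars out of the
    argument of [B]. *)
Lemma mulmx_symZ (R : comPzRingType) n m (B : 'rV[R]_n -> 'M[R]_(n, m)) a b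
    (X Y : 'rV[R]_n) :
  (forall v w : 'rV[R]_n, v *m B w = w *m B v) ->
  (b *: Y) *m B (a *: X) = (a * b) *: (Y *m B X).
Proof.
by move=> sym; rewrite -scalemxAl sym -scalemxAl (sym X) scalerA mulrC.
Qed.

Section SecondFundamentalForm.
Context {R : realType} {n m : nat} {P : manifold R n} (Phi : P -> 'rV[R]_m).
Context (c : chart R n P) (p : P).
Hypotheses (Phi_embedding : embedding Phi) (atlas_c : atlas c) (dom_p : dom c p).

Let F := Phi \o param c.
Let u0 := coords c p.
Let alpha := second_fundamental_form Phi c p.

Let F_smooth : smooth_on (cod c) F.
Proof. by case: Phi_embedding => Fs _ _ _; exact: Fs. Qed.

Let cod_u0 : cod c u0. Proof. exact: coords_cod. Qed.

Let oc : open (cod c). Proof. exact: cod_open. Qed.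

Lemma second_fundamental_formE X Y :
  alpha X Y = Y *m jacobian_derivative F u0 X *m orthoproj (Defs.normal_space Phi c p).
Proof. by rewrite (mulmx_jacobian_derivative oc F_smooth _ _ cod_u0). Qed.

Lemma second_fundamental_formZ a b X Y :
  alpha (a *: X) (b *: Y) = (a * b) *: alpha X Y.
Proof.
have sym v w := jacobian_derivative_sym oc F_smooth v w cod_u0.
rewrite second_fundamental_formE (second_fundamental_formE X Y).
rewrite (mulmx_symZ a b X Y sym); exact: esym (scalemxAl _ _ _).
Qed.

Lemma second_fundamental_form_normal X Y :
  (alpha X Y <= Defs.normal_space Phi c p)%MS.
Proof. exact: proj_mx_sub. Qed.

Lemma second_fundamental_form_equivariant (f : P -> P) (M : 'M[R]_m) X Y :
  smooth_map f -> f p = p -> (forall x, Phi (f x) = Phi x *m M) ->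
  M *m M^T = 1%:M -> let A := jacobian (local_map c c f) u0 in
  A \in unitmx -> alpha (X *m A) (Y *m A) = alpha X Y *m M.
Proof.
move=> [fc fs] fp fM MM A Au.
pose U := cod c `&` (f \o param c) @^-1` dom c.
pose phi := local_map c c f.
have oU : open U.
  rewrite openE => u [cu du]; apply: filterI; first exact: open_near oc _ cu.
  apply: (@continuous_comp _ _ _ (param c) f); first exact: param_continuous.
    exact: fc.
  exact: open_nbhs_nbhs (conj (@dom_open _ _ _ c) du).
have phi_smooth : smooth_on U phi by exact: fs.
have phiV y : U y -> cod c (phi y) by move=> [_ dy]; exact: coords_cod.
have phiF y : U y -> F (phi y) = F y *m M.
  by move=> [cy dy]; rewrite /F /phi /local_map /= coordsK// fM.
have Uu : U u0 by split => //=; rewrite coordsK// fp.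
have phiu : phi u0 = u0 by rewrite /phi /local_map /= coordsK// fp.
have pd : differentiable phi u0 by exact: smooth_differentiable phi_smooth Uu.
have E := second_derive_equivariant oU oc F_smooth phi_smooth phiV phiF Y X
  Uu cod_u0 phiu.
pose D := jacobian F u0.
(* The first-order equivariance shows that [M] preserves the tangent space, so it commutes with the
   normal projection. *)
have DA : D *m M = A *m D.
  apply/row_matrixP => i; rewrite !rowE !mulmxA.
  rewrite -(deriveEjacobian _ (smooth_differentiable F_smooth cod_u0)).
  rewrite (derive_equivariant oU F_smooth phi_smooth phiV phiF _ Uu cod_u0).
  by rewrite (deriveEjacobian _ pd) phiu.
rewrite !(deriveEjacobian _ pd) -/A in E.
rewrite /alpha /second_fundamental_form -(orthoproj_orthogonal _ MM Au DA) -/F -/u0.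
rewrite [X in _ = X *m _]E mulmxDl.
by rewrite [X in _ = _ + X]orthoproj_orthocompl_row addr0.
Qed.

End SecondFundamentalForm.

(** * The (1,1)-part *)

Section Complexification.
Context {R : realType} {n m : nat} (J : 'M[R]_n).
Implicit Types (X Y : 'rV[R]_n) (a : 'rV[R]_n -> 'rV[R]_n -> 'rV[R]_m).

Let half : (2^-1 : R[i]%C) = (2^-1)%:C%C.
Proof. by rewrite fmorphV rmorph_nat. Qed.

Lemma re_part10 X : re_part (part10 J X) = 2^-1 *: X.
Proof. by apply/rowP => k; rewrite !mxE half /=; ring. Qed.

Lemma im_part10 X : im_part (part10 J X) = (- 2^-1) *: (X *m J).
Proof. by apply/rowP => k; rewrite !mxE half /=; ring. Qed.

Lemma re_part01 X : re_part (part01 J X) = 2^-1 *: X.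
Proof. by apply/rowP => k; rewrite !mxE half /=; ring. Qed.

Lemma im_part01 X : im_part (part01 J X) = 2^-1 *: (X *m J).
Proof. by apply/rowP => k; rewrite !mxE half /=; ring. Qed.

Lemma bilinear_extE a Z W x1 x2 y1 y2 : re_part Z = x1 -> im_part Z = x2 ->
  re_part W = y1 -> im_part W = y2 ->
  bilinear_ext a Z W = complexify (a x1 y1 - a x2 y2) +
    'i%C *: complexify (a x1 y2 + a x2 y1).
Proof. by rewrite /bilinear_ext => -> -> -> ->. Qed.

(** The real and imaginary parts of all arguments are multiples by 1/2, up to sign, of [X],
    [X *m J], [Y] and [Y *m J]. The two real contributions are equal, the two imaginary ones
    opposite. *)
Lemma part11E a X Y :
  (forall x y X Y, a (x *: X) (y *: Y) = (x * y) *: a X Y) ->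
  part11 J a X Y = complexify (2^-1 *: (a X Y + a (X *m J) (Y *m J))).
Proof.
move=> aZ; rewrite /part11.
rewrite (bilinear_extE a (re_part10 X) (im_part10 X) (re_part01 Y) (im_part01 Y)).
rewrite (bilinear_extE a (re_part01 X) (im_part01 X) (re_part10 Y) (im_part10 Y)).
move: (X *m J) (Y *m J) => X' Y'; rewrite !aZ.
apply/rowP => k; rewrite !mxE /=; apply/eqP.
by rewrite eq_complex /=; apply/andP; split; apply/eqP; field.
Qed.

End Complexification.

Theorem proposition1 (R : realType) (n m : nat) (P : manifold R n)
    (g : riemannian_metric P) (G : set (P -> P)) (s : P -> P -> P)
    (rho : (P -> P) -> 'M[R]_m) (Phi : P -> 'rV[R]_m)
    (G_group : isometry_group g G)
    (G_transitive : transitive_on G)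
    (s_symmetry : forall q : P, geodesic_symmetry g q (s q))
    (G_symmetry : forall q : P, G (s q))
    (rho_rep : orthogonal_representation G rho)
    (Phi_embedding : embedding Phi)
    (Phi_equivariant : equivariant G rho Phi)
    (p : P) (c : chart R n P) (atlas_c : atlas c) (dom_p : dom c p) :
  (forall X Y : 'rV[R]_n,
    (second_fundamental_form Phi c p X Y
      <= normal_fixed Phi c p (rho (s p)))%MS) /\
  (forall (J : kaehler_structure g) (S : P -> set (P -> P)),
    kaehler_symmetric G s J S ->
    forall j : P -> P, acts_as_J J (S p) p j ->
    forall X Y : 'rV[R]_n,
      part11 (cplx J c (coords c p)) (second_fundamental_form Phi c p) X Y =
      complexify (second_fundamental_form Phi c p X Y *m
        orthoproj (normal_fixed Phi c p (rho j)))).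
Proof.
have [G_isom _ _ _] := G_group; have [rho_orth _] := rho_rep.
set alpha := second_fundamental_form Phi c p.
have alphaZ := second_fundamental_formZ Phi_embedding atlas_c dom_p.
have alphaN X Y : alpha (- X) (- Y) = alpha X Y.
  by have := alphaZ (- 1) (- 1) X Y; rewrite !scaleN1r mulrNN mulr1 scale1r.
have alpha_normal X Y : (alpha X Y <= Defs.normal_space Phi c p)%MS.
  exact: second_fundamental_form_normal.
have alphaE f : G f -> f p = p ->
    let A := jacobian (local_map c c f) (coords c p) in A \in unitmx ->
    forall X Y, alpha (X *m A) (Y *m A) = alpha X Y *m rho f.
  move=> Gf fp A Au X Y; have [f_smooth _] := G_isom f Gf.
  apply: (second_fundamental_form_equivariant Phi_embedding atlas_c dom_p) => //.
    by move=> x; exact: Phi_equivariant.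
  exact: rho_orth.
split=> [X Y|J S kaehler j [Sj jJ] X Y].
  rewrite sub_capmx alpha_normal; apply/eigenspaceP; rewrite scale1r.
  have [_ sp _] := s_symmetry p.
  have sJ := symmetry_jacobian atlas_c dom_p (s_symmetry p).
  have := alphaE (s p) (G_symmetry p) sp; rewrite sJ => <-.
    by rewrite !mulmxN !mulmx1 alphaN.
  have /mulmx1_unit[//] : - 1%:M *m - 1%:M = 1%:M :> 'M[R]_n.
  by rewrite mulmxN mulNmx mulmx1 opprK.
set J0 := cplx J c (coords c p).
have [[SG [e [SE _ _ _ eP]]] _] := kaehler p.
have Gj : G j by exact: SG.
(* As a member of the circle group, [j] is some [e a], and these all fix [p]. *)
have jp : j p = p by move: Sj; rewrite SE => -[a _ <-]; exact: (eP a).1.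
have JJ : J0 *m J0 = - 1%:M by apply: cplx_sqr => //; exact: coords_cod.
have Ju : J0 \in unitmx.
  have /mulmx1_unit[] // : J0 *m (- J0) = 1%:M by rewrite mulmxN JJ opprK.
have alphaJ X' Y' : alpha (X' *m J0) (Y' *m J0) = alpha X' Y' *m rho j.
  by have := alphaE j Gj jp; rewrite jJ// => /(_ Ju X' Y').
have alphaMM : alpha X Y *m rho j *m rho j = alpha X Y.
  by rewrite -!alphaJ -!mulmxA JJ !mulmxN !mulmx1 alphaN.
rewrite part11E// -/alpha alphaJ; congr (complexify _); apply/esym.
set K := normal_fixed Phi c p (rho j).
have KM : K *m rho j = K.
  have : (K <= eigenspace (rho j) 1)%MS by exact: capmxSr.
  by move/eigenspaceP; rewrite scale1r.
(* The half sum must lie in [K], where [alphaMM] shows that [rho j] exchanges its two summands, and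
   the remainder must be orthogonal to [K]. *)
apply: orthoprojP.
  rewrite sub_capmx scalemx_sub ?addmx_sub//=; last by rewrite -alphaJ.
  apply/eigenspaceP.
  by rewrite -scalemxAl mulmxDl alphaMM scale1r addrC.
rewrite sub_orthocompl.
(* Vectors of [K] are fixed by the orthogonal map [rho j], so applying [rho j] to [alpha X Y] does
   not change its inner products with them. *)
have alphaK : alpha X Y *m rho j *m K^T = alpha X Y *m K^T.
  rewrite -[in LHS]KM (trmx_mul K (rho j)) mulmxA -(mulmxA (alpha X Y)).
  by rewrite rho_orth// mulmx1.
rewrite mulmxBl -scalemxAl mulmxDl alphaK; move: (alpha X Y *m K^T) => v.
by apply/eqP/rowP => k; rewrite !mxE; field.
Qed.
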